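(* There exist a connected network $(V,c_\infty)$ with $\pi_\infty(v)<\infty$ for all $v\in V$, a vertex $v_0\in V$, and a deterministic non-increasing sequence of conductances $(c_t)_{t\in\mathbb{N}}$ on $V$ with $c_t\downarrow c_\infty$ pointwise and $\pi_t(v)<\infty$ for all $t\in\mathbb{N}$, $v\in V$, such that every network $(V,c_t)$ for $t\in\mathbb{N}\cup\{\infty\}$ is transient, and yet the random walk $(X_t)_{t\ge0}$ in the changing environment $(c_t)_{t\ge0}$ with $X_0=v_0$ almost surely visits every vertex of $V$ infinitely often. In particular, it is false that whenever $c_t\downarrow c_\infty$ and the random walk on $c_\infty$ is irreducible and transient, the walk $(X_t)_{t\ge0}$ must almost surely visit every vertex finitely often.
   Context: A network $(V,c)$ is a countable vertex set $V$ with symmetric conductances $c:V\times V\to[0,\infty)$; its edges are the pairs $e$ with $c(e)>0$. The total conductance of a vertex is $\pi(y)=\sum_z c(y,z)$ ($\pi_t$ denotes the one for $c_t$). The random walk on $(V,c)$ at $y$ jumps to $z$ with probability $c(y,z)/\pi(y)$; the network is called transient (recurrent) if this time-homogeneous walk is. The random walk in the changing environment $(c_t)_{t\ge0}$ is the time-inhomogeneous Markov chain with $\mathbb{P}(X_{t+1}=z\mid X_t=y)=c_t(y,z)/\pi_t(y)$. *)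

(* Defs.v *)
From HB Require Import structures.
From mathcomp Require Import all_boot all_order all_algebra.
From mathcomp Require Import all_classical all_reals all_analysis.
Set Implicit Arguments.
Unset Strict Implicit.
Unset Printing Implicit Defensive.
Import Order.TTheory GRing.Theory Num.Theory.
Import numFieldNormedType.Exports.
Local Open Scope classical_set_scope.
Local Open Scope ring_scope.

Definition is_network (R : realType) (V : countType) (c : V -> V -> R) : Prop :=
  (forall x y, 0 <= c x y) /\ (forall x y, c x y = c y x).

Definition connected_network (R : realType) (V : countType)
    (c : V -> V -> R) : Prop :=
  forall x y, exists2 s : seq V, path (fun a b => 0 < c a b) x s & last x s = y.

Definition total_conductance (R : realType) (V : countType)
    (c : V -> V -> R) (y : V) : \bar R :=
  \esum_(z in [set: V]) (c y z)%:E.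

Definition locally_finite (R : realType) (V : countType)
    (c : V -> V -> R) : Prop :=
  forall v, (total_conductance c v < +oo)%E.

(* Used only when the total conductance is finite; at a vertex of total
   conductance 0, where the walk is undefined, this is the zero row, so no
   process satisfying [is_walk] can visit such a vertex with positive
   probability. *)
Definition step_prob (R : realType) (V : countType)
    (c : V -> V -> R) (y z : V) : R :=
  c y z / fine (total_conductance c y).

(* The Markov property is stated on cylinder events and in product form, so that
   no conditioning on null events occurs. Measurability is with respect to the
   discrete sigma-algebra on the countable set V. *)
Definition is_walk (R : realType) (V : countType) (c : nat -> V -> V -> R)
    (v0 : V) (d : measure_display) (T : measurableType d)
    (P : probability T R) (X : nat -> T -> V) : Prop :=
  [/\ forall t v, measurable [set w | X t w = v],
      P [set w | X 0%N w = v0] = 1%E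
    & forall (t : nat) (x : nat -> V),
        P [set w | forall s, (s <= t.+1)%N -> X s w = x s] =
        (P [set w | forall s, (s <= t)%N -> X s w = x s] *
         (step_prob (c t) (x t) (x t.+1))%:E)%E ].

(* [is_walk] determines the law of X, so in the next two definitions the choice
   of the process realizing the walk is immaterial. It is quantified
   existentially so that nothing holds vacuously for a network whose walk is
   undefined. *)
Definition transient (R : realType) (V : countType) (c : V -> V -> R) : Prop :=
  forall v, exists (d : measure_display) (T : measurableType d)
      (P : probability T R) (X : nat -> T -> V),
    is_walk (fun=> c) v P X /\
    (P [set w | exists n, X n.+1 w = v] < 1)%E.

Definition irreducible_walk (R : realType) (V : countType)
    (c : V -> V -> R) : Prop :=
  forall x y, exists (d : measure_display) (T : measurableType d)
      (P : probability T R) (X : nat -> T -> V),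
    is_walk (fun=> c) x P X /\
    exists n, (0 < P [set w | X n w = y])%E.

Definition decreases_to (R : realType) (V : countType)
    (c : nat -> V -> V -> R) (cinf : V -> V -> R) : Prop :=
  forall x y, nonincreasing_seq (fun t => c t x y) /\
    (c t x y @[t --> \oo] --> cinf x y).

Definition visits_infinitely_often (V : Type) (x : nat -> V) (v : V) : Prop :=
  forall N : nat, exists2 n : nat, (N <= n)%N & x n = v.

Definition visits_finitely_often (V : Type) (x : nat -> V) (v : V) : Prop :=
  exists N : nat, forall n : nat, (N <= n)%N -> x n <> v.

(* Main.v *)
(* The vertices are those of a ray with rapidly growing conductances, together
   with a trap hanging from each vertex of the ray; every vertex is moreover
   joined to the origin 0 by an edge of small conductance that never changes.
   The rung leading from the k-th vertex of the ray to its trap, and the loop at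
   the trap, are much heavier than the continuation of the ray, but they are
   deleted at a deterministic time s_k. Between s_(n-1) and s_n the walk, wherever
   it is below level n, moves up the ray, falls into the n-th trap (the lower traps
   being deleted) and is held there with probability tending to 1; when the trap is
   deleted its only neighbour is 0, so one step later the walk is at 0. Since 0 is
   adjacent to every vertex, with jump probabilities that do not depend on time,
   every vertex is visited infinitely often. Each frozen network is transient
   because it carries a positive superharmonic function without local minimum: an
   excursion into a trap does not prevent the walk from escaping along the ray. *)
Require Import Defs.
From HB Require Import structures.
From mathcomp Require Import all_boot all_order all_algebra.
From mathcomp Require Import all_classical all_reals all_analysis.
From mathcomp Require Import ring lra zify.
Set Implicit Arguments.
Unset Strict Implicit.
Unset Printing Implicit Defensive.
Import Order.TTheory GRing.Theory Num.Theory.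
Import numFieldNormedType.Exports.
Local Open Scope classical_set_scope.
Local Open Scope ring_scope.

Lemma nneseries_ge_term (R : realType) (u : nat -> R) n :
  (forall k, 0 <= u k) -> ((u n)%:E <= \sum_(k <oo) (u k)%:E)%E.
Proof.
move=> u0; rewrite (nneseriesD1 (n := n))//; last by move=> k _; rewrite lee_fin.
by rewrite leeDl// nneseries_ge0// => k _ _; rewrite lee_fin.
Qed.

(** * The Markov property and expectations along the walk *)

Section walk.
Context (R : realType) (c : nat -> nat -> nat -> R) (v0 : nat).
Context (d : measure_display) (T : measurableType d) (P : probability T R).
Context (X : nat -> T -> nat).
Hypothesis Xc : is_walk c v0 P X.

Lemma walk_measurable_pre s (Q : set nat) : measurable [set w | Q (X s w)].
Proof.
have [mX _ _] := Xc.
have -> : [set w | Q (X s w)] = \bigcup_(v in Q) [set w | X s w = v].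
  by apply/seteqP; split => [w Qw|w [v Qv /= ->]//]; exists (X s w).
by apply: bigcup_measurable => v _; exact: mX.
Qed.

Lemma walk_measurable_all (D : set nat) (Q : nat -> set nat) :
  measurable [set w | forall s, D s -> Q s (X s w)].
Proof.
have -> : [set w | forall s, D s -> Q s (X s w)] =
    \bigcap_s [set w | D s -> Q s (X s w)].
  by apply/seteqP; split => w H s; [move=> _; exact: H|exact: H].
apply: bigcapT_measurable => s.
exact: (walk_measurable_pre s [set v | D s -> Q s v]).
Qed.

Lemma walk_partition s (A : set T) : measurable A ->
  P A = (\sum_(v <oo) P (A `&` [set w | X s w = v]))%E.
Proof.
move=> mA; have [mX _ _] := Xc.
rewrite -measure_semi_bigcup.
- congr (P _); apply/seteqP; split => [w Aw|w [v _ []]//].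
  by exists (X s w).
- by move=> v; apply: measurableI => //; exact: mX.
- by move=> i j _ _ [w [[_ /= <-] [_ /= <-]]].
- by apply: bigcupT_measurable => v; apply: measurableI => //; exact: mX.
Qed.

(** Interpolates between the cylinder events of [is_walk] ([j = 0]) and the events on which only the
    last position is prescribed ([j = t]). Summing over the value of [X j] passes from [j] to
    [j.+1], so induction on [j] carries the product formula from the former to the latter. *)
Let constr (B : nat -> set nat) j (y : nat -> nat) t :=
  [set w | (forall s, (s < j)%N -> B s (X s w)) /\
           (forall s, (j <= s <= t)%N -> X s w = y s)].

Let constr_measurable B j y t : measurable (constr B j y t).
Proof.
apply: measurableI; first exact: (walk_measurable_all [set s | (s < j)%N] B).
exact: (walk_measurable_all [set s | (j <= s <= t)%N] (fun s v => v = y s)).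
Qed.

Let constrS B j y t v : (j < t)%N ->
  constr B j.+1 y t `&` [set w | X j w = v] =
  if `[< B j v >] then constr B j (fun s => if s == j then v else y s) t
  else set0.
Proof.
move=> jt; case: asboolP => Bjv; apply/seteqP; split => //= w.
- move=> [[Bw yw] Xv]; split=> [s sj|s].
    by apply: Bw; exact: ltnW.
  by case: eqVneq => [->//|sj] jst; apply: yw; lia.
- move=> [Bw yw]; have Xv : X j w = v by rewrite yw ?eqxx// leqnn/= ltnW.
  split => //; split=> [s|s /andP[js st]].
    by rewrite ltnS leq_eqVlt => /predU1P[->|/Bw//]; rewrite Xv.
  by rewrite yw; [case: eqVneq => // sj; lia|lia].
- by move=> [[Bw yw] Xv]; apply: Bjv; rewrite -Xv; apply: Bw.
Qed.

Let markov_aux B t j : (j <= t)%N -> forall y,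
  P (constr B j y t.+1) =
  (P (constr B j y t) * (step_prob (c t) (y t) (y t.+1))%:E)%E.
Proof.
elim: j => [_|j IH jt] y.
  have cE u : constr B 0 y u = [set w | forall s, (s <= u)%N -> X s w = y s].
    by apply/seteqP; split => [w [_ +] s|w H]; [exact|split].
  by rewrite !cE; have [_ _ ->] := Xc.
rewrite (walk_partition j (constr_measurable _ _ _ _)).
rewrite [in RHS](walk_partition j (constr_measurable _ _ _ _)).
rewrite [RHS]muleC -nneseriesZl; last by move=> *; exact: measure_ge0.
apply: eq_eseriesr => v _; rewrite !constrS//; last exact: ltnW.
case: asboolP => _; last by rewrite measure0 mule0.
by rewrite IH ?(ltnW jt)// muleC gtn_eqF// gtn_eqF// ltnW.
Qed.

(** The sets [B s] depend on time so that one notion covers avoiding a vertex from time [N] on, not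
    returning after time 0, and, for [setT], the plain law of [X t]. *)
Definition constrained (B : nat -> set nat) t (x : nat) :=
  [set w | (forall s, (s <= t)%N -> B s (X s w)) /\ X t w = x].

Lemma constrained_measurable B t x : measurable (constrained B t x).
Proof.
have [mX _ _] := Xc; apply: measurableI; last exact: mX.
exact: (walk_measurable_all [set s | (s <= t)%N]).
Qed.

Lemma constrained0 (B : nat -> set nat) t x : ~ B t x -> constrained B t x = set0.
Proof.
move=> nB; apply/seteqP; split => // w [Bw Xx].
by apply: nB; rewrite -Xx; exact: Bw.
Qed.

Lemma markov B t x z :
  P (constrained B t x `&` [set w | X t.+1 w = z]) =
  (P (constrained B t x) * (step_prob (c t) x z)%:E)%E.
Proof.
have [Btx|/constrained0->] := pselect (B t x); last first.
  by rewrite set0I measure0 mul0e.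
have := @markov_aux B t t (leqnn t) (fun s => if s == t then x else z).
rewrite eqxx gtn_eqF//; set y := (fun s => _).
have -> : constr B t y t.+1 = constrained B t x `&` [set w | X t.+1 w = z].
  apply/seteqP; split => w /=.
    move=> [Bw Xw]; have Xx : X t w = x by rewrite Xw /y ?eqxx// leqnn/= leqnSn.
    split; last by rewrite Xw /y ?gtn_eqF// leqnSn leqnn.
    by split => // s; rewrite leq_eqVlt => /predU1P[->|/Bw//]; rewrite Xx.
  move=> [[Bw Xx] Xz]; split=> [s st|s]; first by apply: Bw; exact: ltnW.
  by rewrite /y; case: eqVneq => [->//|st] ?; have -> : s = t.+1 by lia.
suff -> : constr B t y t = constrained B t x by [].
apply/seteqP; split => w /=.
  move=> [Bw Xw]; have Xx : X t w = x by rewrite Xw /y ?eqxx// leqnn.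
  by split => // s; rewrite leq_eqVlt => /predU1P[->|/Bw//]; rewrite Xx.
move=> [Bw Xx]; split=> [s st|s]; first by apply: Bw; exact: ltnW.
by rewrite /y; case: eqVneq => [->//|st] ?; lia.
Qed.

Local Open Scope ereal_scope.

(** The expectation of [g (X t)] restricted to the event that [X s] lies in [B s] for all [s <= t],
    as a series over the possible positions. *)
Definition expect (B : nat -> set nat) t (g : nat -> R) : \bar R :=
  \sum_(x <oo) P (constrained B t x) * (g x)%:E.

Lemma expect_ge0 B t g : (forall x, 0 <= g x)%R -> 0 <= expect B t g.
Proof. by move=> g0; apply: nneseries_ge0 => x _ _; rewrite mule_ge0 ?lee_fin. Qed.

Lemma expect_le (B : nat -> set nat) t g h : (forall x, 0 <= g x)%R ->
  (forall x, B t x -> g x <= h x)%R -> expect B t g <= expect B t h.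
Proof.
move=> g0 gh; apply: lee_nneseries => [x _ _|x _]; first by rewrite mule_ge0 ?lee_fin.
have [Bx|/constrained0 ->] := pselect (B t x); last by rewrite measure0 !mul0e.
by rewrite lee_wpmul2l ?lee_fin ?gh.
Qed.

Lemma expect_le_setT B t g : (forall x, 0 <= g x)%R ->
  expect B t g <= expect (fun=> setT) t g.
Proof.
move=> g0; apply: lee_nneseries => [x _ _|x _]; first by rewrite mule_ge0 ?lee_fin.
rewrite lee_wpmul2r ?lee_fin// le_measure ?inE//; try exact: constrained_measurable.
by move=> w [].
Qed.

Lemma expectD B t g h : (forall x, 0 <= g x)%R -> (forall x, 0 <= h x)%R ->
  expect B t (fun x => g x + h x)%R = expect B t g + expect B t h.
Proof.
move=> g0 h0; rewrite /expect -nneseriesD => [|x _ _|x _ _].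
- by apply: eq_eseriesr => x _; rewrite EFinD ge0_muleDr ?lee_fin.
- by rewrite mule_ge0 ?lee_fin.
- by rewrite mule_ge0 ?lee_fin.
Qed.

Lemma expectZ B t a g : (forall x, 0 <= g x)%R ->
  expect B t (fun x => a * g x)%R = a%:E * expect B t g.
Proof.
move=> g0; rewrite /expect -nneseriesZl => [|x _].
- by apply: eq_eseriesr => x _; rewrite EFinM muleCA.
- by rewrite mule_ge0 ?lee_fin.
Qed.

Lemma expect1 B t :
  expect B t (fun=> 1%R) = P [set w | forall s, (s <= t)%N -> B s (X s w)].
Proof.
rewrite (walk_partition t); last exact: (walk_measurable_all [set s | (s <= t)%N]).
by apply: eq_eseriesr => x _; rewrite mule1.
Qed.

Lemma expect1_le1 B t : expect B t (fun=> 1%R) <= 1.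
Proof.
rewrite expect1; apply: probability_le1.
exact: (walk_measurable_all [set s | (s <= t)%N]).
Qed.

Lemma expect_cst B t a : (0 <= a)%R -> expect B t (fun=> a) <= a%:E.
Proof.
move=> a0; rewrite (_ : (fun=> a) = (fun=> a * 1)%R); last first.
  by apply/funext => x; rewrite mulr1.
by rewrite expectZ// -[leRHS]mule1 lee_wpmul2l ?lee_fin// expect1_le1.
Qed.

Lemma walk_start B x : B 0%N v0 ->
  P (constrained B 0 x) = if x == v0 then 1 else 0.
Proof.
move=> Bv0; have [mX P0 _] := Xc; case: eqVneq => [->|xv0].
  rewrite -P0; congr (P _); apply/seteqP; split => w /=; first by case.
  by move=> Xv0; split => // s; rewrite leqn0 => /eqP->; rewrite Xv0.
have : P (~` [set w | X 0%N w = v0]) = 0.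
  by rewrite probability_setC// P0 subee.
apply: subset_measure0 => //; first exact: constrained_measurable.
  exact: measurableC.
by move=> w [_ /= ->]; exact/eqP.
Qed.

Lemma expect0 B g : B 0%N v0 -> (forall x, 0 <= g x)%R ->
  expect B 0 g = (g v0)%:E.
Proof.
move=> Bv0 g0; rewrite /expect (nneseriesD1 (n := v0))//; last first.
  by move=> x _; rewrite mule_ge0 ?lee_fin.
rewrite walk_start// eqxx mul1e eseries0 ?adde0// => x _ /negPf xv0.
by rewrite walk_start// xv0 mul0e.
Qed.

Hypothesis p_ge0 : forall t x z, (0 <= step_prob (c t) x z)%R.

(** Condition on the position at time [t] with [markov] and exchange the two nonnegative series; the
    indicator records the new constraint at time [t.+1]. *)
Lemma expectS B t g : (forall x, 0 <= g x)%R ->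
  expect B t.+1 g = \sum_(x <oo) P (constrained B t x) *
    \sum_(z <oo) (step_prob (c t) x z * (g z * (`[< B t.+1 z >])%:R))%:E.
Proof.
move=> g0; have g0' z : (0 <= g z * (`[< B t.+1 z >])%:R)%R by rewrite mulr_ge0.
transitivity (\sum_(x <oo) \sum_(z <oo) P (constrained B t x) *
    (step_prob (c t) x z * (g z * (`[< B t.+1 z >])%:R))%:E); last first.
  apply: eq_eseriesr => x _.
  rewrite -[P _]fineK; last by rewrite fin_num_measure//; exact: constrained_measurable.
  by rewrite nneseriesZl// => z _; rewrite lee_fin mulr_ge0.
rewrite nneseries_interchange; last first.
  by move=> x z; apply: mule_ge0 => //; rewrite lee_fin mulr_ge0.
apply: eq_eseriesr => z _.
transitivity (P (constrained B t.+1 z) * (g z * (`[< B t.+1 z >])%:R)%:E).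
  case: asboolP => [_|nB]; first by rewrite mulr1.
  by rewrite constrained0// measure0 !mul0e.
rewrite muleC (walk_partition t); last exact: constrained_measurable.
rewrite -nneseriesZl; last by move=> *; exact: measure_ge0.
apply: eq_eseriesr => x _; rewrite [in RHS]EFinM [RHS]muleA -markov.
case: asboolP => [Bz|_]; last by rewrite mulr0 mul0e mule0.
rewrite muleC; congr (P _ * _); apply/seteqP; split => w /=.
  move=> [[Bw Xz] Xx]; split => //; split => // s st; apply: Bw.
  exact: leq_trans st (leqnSn _).
move=> [[Bw Xx] Xz]; split => //; split => // s; rewrite leq_eqVlt.
by move=> /predU1P[->|/Bw//]; rewrite Xz.
Qed.

Lemma expectS_le B t g h : (forall x, 0 <= g x)%R ->
  (forall x, \sum_(z <oo) (step_prob (c t) x z * g z)%:E <= (h x)%:E) ->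
  expect B t.+1 g <= expect B t h.
Proof.
move=> g0 gh; rewrite expectS//; apply: lee_nneseries => [x _ _|x _].
  apply: mule_ge0; [exact: measure_ge0|apply: nneseries_ge0 => z _ _].
  by rewrite lee_fin; do 2![apply: mulr_ge0 => //].
rewrite lee_wpmul2l//; apply: le_trans (gh x).
apply: lee_nneseries => [z _ _|z _].
  by rewrite lee_fin; do 2![apply: mulr_ge0 => //].
rewrite lee_fin ler_wpM2l// ler_piMr//.
by case: asboolP.
Qed.

(** For a lower bound the indicator in [expectS] cannot be dropped; requiring [g] to vanish off
    [B t.+1] makes it harmless. *)
Lemma expectS_ge B t g h : (forall x, 0 <= g x)%R -> (forall x, 0 <= h x)%R ->
  (forall z, ~ B t.+1 z -> g z = 0%R) ->
  (forall x, (h x)%:E <= \sum_(z <oo) (step_prob (c t) x z * g z)%:E) ->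
  expect B t h <= expect B t.+1 g.
Proof.
move=> g0 h0 gB hg; rewrite expectS//; apply: lee_nneseries => [x _ _|x _].
  by apply: mule_ge0; [exact: measure_ge0|rewrite lee_fin].
rewrite lee_wpmul2l//; apply: (le_trans (hg x)); apply: lee_nneseries => [z _ _|z _].
  by rewrite lee_fin mulr_ge0.
by case: asboolP => [_|/gB ->]; rewrite ?mulr1// mul0r.
Qed.

Hypothesis p_sum1 : forall t x, \sum_(z <oo) (step_prob (c t) x z)%:E = 1.

(** * Criteria for certain visits and for escape with positive probability *)

Section avoidance.
Variables (v : nat) (p0 : R).
Hypotheses (p0_gt0 : (0 < p0)%R)
  (p0_le : forall t, (p0 <= step_prob (c t) v0 v)%R).
Hypothesis back : forall N (e : R), (0 < e)%R -> exists2 t, (N <= t)%N &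
  expect (fun=> setT) t (fun x => (x != v0)%:R) <= e%:E.

(* At time [t] the walk is at [v0] up to probability [e], and from there it hits
   [v] with probability at least [p0]. *)
Lemma avoid_step N t (e : R) : (N <= t.+1)%N ->
  expect (fun=> setT) t (fun x => (x != v0)%:R) <= e%:E ->
  let B := fun s x : nat => (N <= s)%N -> x <> v in
  expect B t.+1 (fun=> 1%R) + p0%:E * expect B t (fun=> 1%R) <=
  expect B t (fun=> 1%R) + (p0 * e)%:E.
Proof.
move=> Nt te /=; set B : nat -> set nat := fun _ _ => _ -> _.
pose h x := (1 - p0 * (x == v0)%:R)%R.
have p01 : (p0 <= 1)%R.
  apply: (le_trans (p0_le 0%N)); rewrite -lee_fin -(p_sum1 0 v0).
  exact: nneseries_ge_term.
have h0 x : (0 <= h x)%R.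
  by rewrite /h; case: eqP => _; rewrite ?mulr1 ?mulr0 ?subr0// subr_ge0.
have step : expect B t.+1 (fun=> 1%R) <= expect B t h.
  apply: (@le_trans _ _ (expect B t.+1 (fun z => (z != v)%:R))).
    by apply: expect_le => // x /(_ Nt)/eqP ->.
  apply: expectS_le => // x.
  have le1 : \sum_(z <oo) (step_prob (c t) x z * (z != v)%:R)%:E +
     (step_prob (c t) x v)%:E <= 1.
    rewrite -(p_sum1 t x) [leRHS](nneseriesD1 (n := v))//; last first.
      by move=> z _; rewrite lee_fin.
    rewrite addeC leeD2l// [leLHS](nneseriesD1 (n := v))//; last first.
      by move=> z _; rewrite lee_fin mulr_ge0.
    rewrite eqxx mulr0 add0e; apply: lee_nneseries => [z _ _|z _].
      by rewrite lee_fin mulr_ge0.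
    by rewrite lee_fin ler_piMr//; case: eqP.
  rewrite /h EFinB leeBrDr//; apply: le_trans le1; rewrite leeD2l// lee_fin.
  by case: eqP => [->|_]; rewrite ?mulr1 ?mulr0.
have hE : expect B t (fun=> 1%R) =
    expect B t h + p0%:E * expect B t (fun x => (x == v0)%:R).
  rewrite -expectZ// -expectD//; last by move=> x; rewrite mulr_ge0// ltW.
  by congr (expect B t _); apply/funext => x; rewrite /h subrK.
have split1 : expect B t (fun=> 1%R) <= expect B t (fun x => (x == v0)%:R) + e%:E.
  apply: (@le_trans _ _ (expect B t (fun x => (x == v0)%:R) +
      expect B t (fun x => (x != v0)%:R))).
    rewrite -expectD//; apply: expect_le => // x _.
    by case: eqP => _; rewrite ?addr0 ?add0r.
  by rewrite leeD2l//; apply: le_trans te; exact: expect_le_setT.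
rewrite [in leRHS]hE.
rewrite EFinM -addeA -ge0_muleDr ?expect_ge0//; last first.
  by apply: le_trans te; exact: expect_ge0.
by rewrite leeD// lee_wpmul2l// lee_fin ltW.
Qed.

(** The probability of avoiding [v] from [N] up to [t] decreases to some [l]. If [l] were positive,
    a late time at which the walk is probably at [v0] would make the next step lose a fixed fraction
    of [l], pushing the probability below its limit. *)
Lemma avoid_null N : P [set w | forall s, (N <= s)%N -> X s w <> v] = 0.
Proof.
pose B s x := (N <= s)%N -> x <> v.
pose F t := [set w | forall s, (s <= t)%N -> B s (X s w)].
have mF t : measurable (F t) by exact: (walk_measurable_all [set s | (s <= t)%N] B).
have FE : [set w | forall s, (N <= s)%N -> X s w <> v] = \bigcap_t F t.
  apply/seteqP; split => [w H t _ s st Ns|w H s Ns]; first exact: H.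
  by apply: (H s I s).
have mcap : measurable (\bigcap_t F t) by apply: bigcapT_measurable.
have fF t : P (F t) = (fine (P (F t)))%:E by rewrite fineK// fin_num_measure.
have : fine \o (P \o F) @ \oo --> fine (P (\bigcap_t F t)).
  apply: fine_cvg; rewrite fineK ?fin_num_measure//.
  apply: nonincreasing_cvg_mu => //.
    by rewrite (le_lt_trans (probability_le1 P (mF 0%N)))// ltry.
  move=> s t st; apply/subsetPset => w H u us; apply: H.
  exact: leq_trans us st.
rewrite FE; set l := fine _ => Fl.
have PE : P (\bigcap_t F t) = l%:E by rewrite fineK// fin_num_measure.
rewrite PE; congr (_%:E); apply/eqP; rewrite eq_le.
have l0 : (0 <= l)%R by rewrite -lee_fin -PE.
rewrite l0 andbT leNgt; apply/negP => l_gt0.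
have lF t : (l <= fine (P (F t)))%R.
  rewrite -lee_fin -fF -PE le_measure ?inE//; exact: bigcap_inf.
have e0 : (0 < p0 * l / 4)%R by rewrite divr_gt0// mulr_gt0.
have /cvgrPdist_lt/(_ _ e0)[M _ HM] := Fl.
have [t Mt te] := back (maxn M N) (divr_gt0 l_gt0 (ltr0Sn R 1)).
have Nt : (N <= t.+1)%N by rewrite (leq_trans _ (leqnSn t))// (leq_trans _ Mt)// leq_maxr.
have := avoid_step Nt te; rewrite /= !expect1 -!/(F _) fF [P (F t)]fF.
rewrite -!EFinM -!EFinD lee_fin.
have := HM t (leq_trans (leq_maxl _ _) Mt).
rewrite /= distrC ger0_norm ?subr_ge0//.
have := lF t.+1; have := lF t.
move: (fine (P (F t))) (fine (P (F t.+1))) => a b; nra.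
Qed.

End avoidance.
End walk.

(** The function [k = max 0 (1 - f / f v)] is subharmonic, at most 1, zero at [v] and positive at
    [z0]. Its expectation on the event of no return is therefore nondecreasing from time 1 on, where
    it is at least [eta = p v z0 * k z0]. As [k <= 1], the event of no return up to any time has
    probability at least [eta]. *)
Lemma superharmonic_no_return (R : realType) (c : nat -> nat -> R) (v z0 : nat)
    (f : nat -> R) (d : measure_display) (T : measurableType d)
    (P : probability T R) (X : nat -> T -> nat) :
  (forall x z, 0 <= step_prob c x z) ->
  (forall x, \sum_(z <oo) (step_prob c x z)%:E = 1)%E ->
  (forall x, 0 < f x) ->
  (forall x, \sum_(z <oo) (step_prob c x z * f z)%:E <= (f x)%:E)%E ->
  0 < step_prob c v z0 -> f z0 < f v ->
  is_walk (fun=> c) v P X -> (P [set w | exists n, X n.+1 w = v] < 1)%E.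
Proof.
move=> p0 p1 f0 fsup pz0 fz0 Xc.
pose k (x : nat) : R := Num.max 0 (1 - f x / f v).
have k0 x : 0 <= k x by rewrite /k le_max lexx.
have kv : k v = 0 by rewrite /k divff ?subrr ?maxxx// gt_eqF.
have k1 x : k x <= 1.
  by rewrite /k ge_max ler01 lerBlDr lerDl divr_ge0// ltW.
have ksub x : ((k x)%:E <= \sum_(z <oo) (step_prob c x z * k z)%:E)%E.
  have S0 : (0 <= \sum_(z <oo) (step_prob c x z * k z)%:E)%E.
    by apply: nneseries_ge0 => z _ _; rewrite lee_fin mulr_ge0.
  have [le0|gt0] := leP (1 - f x / f v) 0; first by rewrite {1}/k max_l.
  have -> : k x = 1 - f x / f v by rewrite /k max_r// ltW.
  rewrite EFinB leeBlDr//.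
  have fv0 : 0 <= (f v)^-1 by rewrite invr_ge0 ltW.
  apply: (@le_trans _ _ (\sum_(z <oo) (step_prob c x z * k z)%:E +
      (f v)^-1%:E * \sum_(z <oo) (step_prob c x z * f z)%:E)%E); last first.
    by rewrite leeD2l// mulrC EFinM lee_wpmul2l// lee_fin.
  have pf0 z : 0 <= step_prob c x z * f z by rewrite mulr_ge0// ltW.
  rewrite -nneseriesZl//; last by move=> z _; rewrite lee_fin.
  rewrite -nneseriesD; last 2 first.
  - by move=> z _ _; rewrite lee_fin mulr_ge0.
  - by move=> z _ _; rewrite -EFinM lee_fin mulr_ge0.
  rewrite -(p1 x); apply: lee_nneseries => [z _ _|z _]; first by rewrite lee_fin.
  rewrite -EFinM -EFinD lee_fin mulrCA -mulrDr ler_peMr//.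
  by rewrite -lerBlDr [(f v)^-1 * _]mulrC /k le_max lexx orbT.
(* Time 0 is exempt because the walk starts at [v]. *)
pose B (s x : nat) := s = 0%N \/ x <> v.
pose eta := step_prob c v z0 * k z0.
have eta0 : 0 < eta.
  rewrite mulr_gt0// /k lt_max ltxx/= subr_gt0.
  by rewrite ltr_pdivrMr ?mul1r.
have kB t z : ~ B t.+1 z -> k z = 0.
  by have [->//|/eqP zv []] := eqVneq z v; right.
have pge (t : nat) x z : 0 <= step_prob c x z by [].
have lower t : (eta%:E <= expect P X B t.+1 k)%E.
  elim: t => [|t IH].
    (* The first step needs its own function, since [k v = 0]: here the jump from [v] to [z0]
       supplies [eta]. *)
    pose h x : R := if x == v then eta else 0.
    have -> : eta%:E = expect P X B 0 h.
      rewrite (expect0 Xc) ?/h ?eqxx//; first by left.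
      by move=> x; case: eqVneq => // _; exact: ltW.
    apply: (expectS_ge Xc) => //.
    - by move=> x; rewrite /h; case: eqVneq => // _; exact: ltW.
    - by move=> x; apply: kB.
    - move=> x; rewrite /h; case: (eqVneq x v) => [->|_].
      apply: (@nneseries_ge_term _ (fun z => step_prob c v z * k z) z0) => z.
      exact: mulr_ge0.
    by apply: nneseries_ge0 => z _ _; rewrite lee_fin mulr_ge0.
  by apply: (le_trans IH); apply: (expectS_ge Xc) => // x; exact: kB.
pose F t := [set w | forall s, (s <= t)%N -> B s (X s w)].
have mF t : measurable (F t) by exact: (walk_measurable_all Xc [set s | (s <= t)%N] B).
have FE : [set w | exists n, X n.+1 w = v] = ~` \bigcap_t F t.
  apply/seteqP; split => [w [n Xn] H|w /= nH].
    by have [//|] := H n.+1 I n.+1 (leqnn _).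
  apply: contrapT => nX; apply: nH => t _ [|s] st; first by left.
  by right => Xs; apply: nX; exists s.
have mcap : measurable (\bigcap_t F t) by apply: bigcapT_measurable.
have etaF t : (eta%:E <= P (F t))%E.
  apply: (@le_trans _ _ (P (F t.+1))); last first.
    by rewrite le_measure ?inE// => w H s st; apply: H; exact: leqW.
  have -> : P (F t.+1) = expect P X B t.+1 (fun=> 1) by rewrite (expect1 Xc).
  apply: (le_trans (lower t)).
  by apply: expect_le => // x _.
have cvF : P \o F @ \oo --> P (\bigcap_t F t).
  apply: nonincreasing_cvg_mu => //.
    by rewrite (le_lt_trans (probability_le1 P (mF 0%N)))// ltry.
  move=> s t st; apply/subsetPset => w H u us; apply: H.
  exact: leq_trans us st.
have etaP : (eta%:E <= P (\bigcap_t F t))%E.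
  rewrite -(cvg_lim _ cvF)//; apply: lime_ge; last by apply: nearW => t; exact: etaF.
  by apply/cvg_ex; exists (P (\bigcap_t F t)).
rewrite FE probability_setC// lteBlDr ?fin_num_measure//.
by rewrite -[ltLHS]adde0 lteD2lE// (lt_le_trans _ etaP).
Qed.

(** * Realisation of a time-inhomogeneous chain on the unit interval *)

Section construction.
Context (R : realType) (p : nat -> nat -> nat -> R) (v0 : nat).
Hypothesis p_ge0 : forall t x z, 0 <= p t x z.
Hypothesis p_sum1 : forall t x, (\sum_(z <oo) (p t x z)%:E = 1)%E.

Let cdf t x n := \sum_(0 <= z < n) p t x z.

Let cdfS t x n : cdf t x n.+1 = cdf t x n + p t x n.
Proof. by rewrite /cdf big_nat_recr. Qed.

Let cdf_le t x m n : (m <= n)%N -> cdf t x m <= cdf t x n.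
Proof.
move=> mn; rewrite /cdf (big_cat_nat (leq0n m) mn)//= lerDl.
by apply: sumr_ge0.
Qed.

Let cdf_ge0 t x n : 0 <= cdf t x n.
Proof. by apply: sumr_ge0. Qed.

Let cdf_le1 t x n : cdf t x n <= 1.
Proof.
rewrite -lee_fin -(p_sum1 t x) /cdf -sumEFin.
by apply: nneseries_lim_ge => k _ _; rewrite lee_fin.
Qed.

Let cdf_exceeds t x u : u < 1 -> exists n, u < cdf t x n.
Proof.
move=> u1; apply: contrapT => /forallNP H.
suff : (\sum_(z <oo) (p t x z)%:E <= u%:E)%E by rewrite p_sum1 lee_fin leNgt u1.
apply: lime_le; first by apply: is_cvg_nneseries => z _ _; rewrite lee_fin.
by apply: nearW => n; rewrite sumEFin lee_fin leNgt; apply/negP/H.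
Qed.

Definition cell t x (a l : R) (z : nat) : set R :=
  [set w | a + l * cdf t x z <= w < a + l * cdf t x z.+1].

Let cell_ex t x a l w : a <= w < a + l -> exists z, cell t x a l z w.
Proof.
move=> /andP[aw wal]; have l0 : 0 < l by rewrite -(ltrD2l a) addr0 (le_lt_trans aw).
have ex : exists n, w < a + l * cdf t x n.
  have [|n] := @cdf_exceeds t x ((w - a) / l).
    by rewrite ltr_pdivrMr// mul1r ltrBlDl.
  by rewrite ltr_pdivrMr// ltrBlDl mulrC; exists n.
(* The least [n] with [w] below the [n]-th division point is not 0, as [cdf] vanishes there; its
   predecessor is the cell containing [w]. *)
case: (ex_minnP ex) => -[|n] wn nmin.
  by move: wn; rewrite /cdf big_geq// mulr0 addr0 ltNge aw.
exists n; rewrite /cell /= wn andbT leNgt; apply/negP => /nmin.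
by rewrite ltnn.
Qed.

Let cell_uniq t x a l w z z' : 0 <= l -> cell t x a l z w -> cell t x a l z' w -> z = z'.
Proof.
move=> l0; suff H y y' : cell t x a l y w -> cell t x a l y' w -> (y' <= y)%N.
  by move=> zw z'w; apply/eqP; rewrite eqn_leq (H z' z)// H.
move=> /andP[_ wy] /andP[y'w _]; rewrite leqNgt; apply/negP => yy'.
have h : a + l * cdf t x y.+1 <= a + l * cdf t x y'.
  by rewrite lerD2l ler_wpM2l// cdf_le.
by have := lt_le_trans wy h; rewrite ltNge y'w.
Qed.

(* The walk is realised on [0, 1): each step subdivides the current interval
   [a, a + l) in proportion to the transition probabilities. *)
Fixpoint subdivision (w : R) (t : nat) : nat * R * R :=
  if t is s.+1 then
    let: (x, a, l) := subdivision w s in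
    let z := xget 0%N [set z | cell s x a l z w] in
    (z, a + l * cdf s x z, l * p s x z)
  else (v0, 0, 1).

(** Left end and length of the interval of points whose trajectory follows [y] up to [t]; unlike
    [subdivision] it does not depend on a point. The length is the product of the transition
    probabilities along [y]. *)
Fixpoint path_cell (y : nat -> nat) (t : nat) : R * R :=
  if t is s.+1 then
    let: (a, l) := path_cell y s in
    (a + l * cdf s (y s) (y s.+1), l * p s (y s) (y s.+1))
  else (0, 1).

Let path_len_ge0 y t : 0 <= (path_cell y t).2.
Proof.
elim: t => [|t] /=; first exact: ler01.
by case: (path_cell y t) => a l /= l0; rewrite mulr_ge0.
Qed.

Let path_itv (y : nat -> nat) t :=
  `[(path_cell y t).1, (path_cell y t).1 + (path_cell y t).2[%classic.

Let path_itvS y t w : path_itv y t.+1 w <->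
  path_itv y t w /\ cell t (y t) (path_cell y t).1 (path_cell y t).2 (y t.+1) w.
Proof.
have := path_len_ge0 y t.
rewrite /path_itv /cell /=; case: (path_cell y t) => a l /= l0.
rewrite !in_itv/= cdfS mulrDr !addrA; split => [/andP[h1 h2]|[]//].
rewrite h1 h2; split => //; apply/andP; split.
  by apply: le_trans h1; rewrite lerDl mulr_ge0.
apply: (lt_le_trans h2); rewrite -addrA -mulrDr -cdfS lerD2l.
by rewrite -[leRHS]mulr1 ler_wpM2l.
Qed.

Let path_itv0 y w : path_itv y 0 w <-> 0 <= w < 1.
Proof. by rewrite /path_itv /= in_itv/= add0r. Qed.

Let subdivision_path y t w : y 0%N = v0 ->
  (forall s, (s <= t)%N -> (subdivision w s).1.1 = y s) ->
  subdivision w t = (y t, (path_cell y t).1, (path_cell y t).2).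
Proof.
move=> y0; elim: t => [|t IH] H; first by rewrite /= y0.
have := H t.+1 (leqnn _).
rewrite /= IH => [|s st]; last by apply: H; exact: leqW.
by case: (path_cell y t) => a l /= ->.
Qed.

Let subdivision_itv y t w : y 0%N = v0 -> 0 <= w < 1 ->
  (forall s, (s <= t)%N -> (subdivision w s).1.1 = y s) <-> path_itv y t w.
Proof.
move=> y0 w01; elim: t => [|t IH].
  split=> [_|_ s]; first by rewrite path_itv0.
  by rewrite leqn0 => /eqP ->.
split => [H|].
  have Ht s : (s <= t)%N -> (subdivision w s).1.1 = y s.
    by move=> st; apply: H; exact: leqW.
  apply/path_itvS; split; first exact/IH.
  have := H t.+1 (leqnn _); rewrite /= (subdivision_path y0 Ht) /= => <-.
  have [z zw] : exists z, cell t (y t) (path_cell y t).1 (path_cell y t).2 z w.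
    by apply: cell_ex; move/IH: Ht; rewrite /path_itv /= in_itv.
  by apply: (@xgetPex _ 0%N [set z | cell t (y t) _ _ z w]); exists z.
move=> /path_itvS[/IH Ht cw] s; rewrite leq_eqVlt => /predU1P[->|]; last exact: Ht.
rewrite /= (subdivision_path y0 Ht) /=.
apply: (cell_uniq (path_len_ge0 y t) _ cw).
by apply: (@xgetPex _ 0%N [set z | cell t (y t) _ _ z w]); exists (y t.+1).
Qed.

(** Off [[0, 1)], a null set for the uniform law, the walk is frozen at [v0], so it starts at [v0]
    at every point. *)
Definition subdivision_walk (t : nat) (w : R) : nat :=
  if 0 <= w < 1 then (subdivision w t).1.1 else v0.

Let cylinder y t := [set w | forall s, (s <= t)%N -> subdivision_walk s w = y s].

Let cylinderE y t : y 0%N = v0 -> cylinder y t `&` `[0, 1[%classic = path_itv y t.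
Proof.
move=> y0; apply/seteqP; split => w /=.
  move=> [H]; rewrite in_itv/= => w01; apply/(subdivision_itv t y0 w01) => s st.
  by have := H s st; rewrite /subdivision_walk w01.
move=> yw; have w01 : 0 <= w < 1.
  apply/(path_itv0 y).
  by elim: t yw => // t IH /path_itvS[/IH].
rewrite in_itv /= w01; split => // s st.
by rewrite /subdivision_walk w01; apply: (iffRL (subdivision_itv t y0 w01)).
Qed.
Let cylinder_start y t : y 0%N <> v0 -> cylinder y t = set0.
Proof.
move=> y0; apply/seteqP; split => // w /(_ 0%N (leq0n t)).
by rewrite /subdivision_walk /= if_same => /esym.
Qed.

Let cylinder_measurable y t : measurable (cylinder y t : set (measurableTypeR R)).
Proof.
have [y0|/cylinder_start -> //] := pselect (y 0%N = v0).
have mD : measurable (`[0, 1[%classic : set (measurableTypeR R)).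
  exact: measurable_itv.
rewrite -[cylinder y t]setIT -(setUv `[0, 1[%classic) setIUr cylinderE//.
apply: measurableU; first exact: measurable_itv.
(* Off [[0, 1)] the cylinder is everything or nothing, according to whether [y] is constantly [v0]
   up to [t]. *)
have [yv|yv] := pselect (forall s, (s <= t)%N -> y s = v0).
  rewrite (_ : _ `&` _ = ~` `[0, 1[%classic); first exact: measurableC.
  apply/seteqP; split => [w []//|w /= wD]; split => // s st.
  by move/negP : wD; rewrite in_itv/= /subdivision_walk yv// => /negPf ->.
rewrite (_ : _ `&` _ = set0)//; apply/seteqP; split => // w /= [Hw /negP].
rewrite in_itv/= => /negPf wD; apply: yv => s st.
by rewrite -Hw// /subdivision_walk wD.
Qed.

(** Start from full cylinders and free the coordinates [0, 1, ...] one at a time, each by a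
    countable union over its value, until only the one at [t] is left. *)
Let subdivision_walk_measurable t v :
  measurable ([set w | subdivision_walk t w = v] : set (measurableTypeR R)).
Proof.
suff H j : (j <= t)%N -> forall y, measurable ([set w | forall s, (j <= s <= t)%N ->
    subdivision_walk s w = y s] : set (measurableTypeR R)).
  rewrite (_ : [set _ | _] = [set w | forall s, (t <= s <= t)%N ->
      subdivision_walk s w = v]); first exact: (H t (leqnn t) (fun=> v)).
  apply/seteqP; split => w /= => [<- s|]; last by apply; rewrite leqnn.
  by rewrite -eqn_leq => /eqP ->.
elim: j => [_ y|j IH jt y]; first exact: (cylinder_measurable y t).
rewrite (_ : [set _ | _] = \bigcup_v [set w | forall s, (j <= s <= t)%N ->
    subdivision_walk s w = if s == j then v else y s]).
  apply: bigcupT_measurable => u.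
  exact: (IH (ltnW jt) (fun s => if s == j then u else y s)).
apply/seteqP; split => w /=.
  move=> H; exists (subdivision_walk j w) => // s.
  by case: eqVneq => [->//|sj] jst; apply: H; lia.
move=> [u _ H] s /andP[js st].
by rewrite H; [rewrite gtn_eqF|rewrite (ltnW js)].
Qed.

Let U : probability (measurableTypeR R) R := uniform_prob (@ltr01 R).

Let uniform_itv (a b : R) : 0 <= a -> a <= b -> b <= 1 ->
  U `[a, b[%classic = (b - a)%:E.
Proof.
move=> a0 ab b1; rewrite /U /= /uniform_prob.
under eq_integral.
  move=> x; rewrite inE/= in_itv/= => /andP[ax xb].
  rewrite /uniform_pdf (le_trans a0 ax) (le_trans (ltW xb) b1)/= subr0 invr1.
  over.
rewrite /= integral_cst//= mul1e lebesgue_measure_itv/= lte_fin.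
by have [->|ab'] := eqVneq a b; rewrite ?ltxx ?subrr// lt_neqAle ab' ab.
Qed.

Let cylinder_prob y t : y 0%N = v0 ->
  U (cylinder y t) = (path_cell y t).2%:E.
Proof.
move=> y0.
have mD : measurable (`[0, 1[%classic : set (measurableTypeR R)).
  exact: measurable_itv.
have := uniform_itv (lexx 0) ler01 (lexx 1); rewrite subr0 => PD.
have PD0 : U (~` `[0, 1[%classic) = 0%E.
  by rewrite probability_setC// PD subee.
rewrite -[cylinder y t]setIT -(setUv `[0, 1[%classic) setIUr measureU//; last 3 first.
- by apply: measurableI => //; exact: cylinder_measurable.
- by apply: measurableI; [exact: cylinder_measurable|exact: measurableC].
- by rewrite setIACA setICr setI0.
rewrite [X in (_ + X)%E](_ : _ = 0)%E; last first.
  apply: subset_measure0 PD0 => //; last exact: measurableC.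
  by apply: measurableI; [exact: cylinder_measurable|exact: measurableC].
rewrite adde0 cylinderE//.
have a0 : 0 <= (path_cell y t).1.
  elim: t => [|t] //=; case: (path_cell y t) (path_len_ge0 y t) => a l /= l0 a0.
  by rewrite addr_ge0// mulr_ge0.
have al1 : (path_cell y t).1 + (path_cell y t).2 <= 1.
  elim: t {a0} => [|t] /=; first by rewrite add0r.
  case: (path_cell y t) (path_len_ge0 y t) => a l /= l0 al.
  apply: le_trans al; rewrite -addrA -mulrDr -cdfS lerD2l.
  by rewrite -[leRHS]mulr1 ler_wpM2l.
have := uniform_itv a0 (_ : _ <= (path_cell y t).1 + (path_cell y t).2) al1.
by rewrite lerDl path_len_ge0 addrAC subrr add0r; apply.
Qed.

Lemma subdivision_walk_law :
  [/\ forall t v, measurable ([set w | subdivision_walk t w = v] :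
        set (measurableTypeR R)),
    uniform_prob (@ltr01 R) [set w | subdivision_walk 0 w = v0] = 1%E
  & forall (t : nat) (y : nat -> nat),
      uniform_prob (@ltr01 R)
        [set w | forall s, (s <= t.+1)%N -> subdivision_walk s w = y s] =
      (uniform_prob (@ltr01 R)
        [set w | forall s, (s <= t)%N -> subdivision_walk s w = y s] *
       (p t (y t) (y t.+1))%:E)%E].
Proof.
rewrite -/U; split=> [|/=|t y].
- exact: subdivision_walk_measurable.
- rewrite (_ : [set _ | _] = setT) ?probability_setT//.
  by apply/seteqP; split => // w _; rewrite /subdivision_walk /= if_same.
- have [y0|y0] := pselect (y 0%N = v0).
    rewrite -/(cylinder y t.+1) -/(cylinder y t) !cylinder_prob//=.
    by case: (path_cell y t).
  by rewrite -/(cylinder y t.+1) -/(cylinder y t) !cylinder_start// measure0 mul0e.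
Qed.
End construction.

Lemma walk_exists (R : realType) (c : nat -> nat -> nat -> R) (v0 : nat) :
  (forall t x z, 0 <= step_prob (c t) x z) ->
  (forall t x, \sum_(z <oo) (step_prob (c t) x z)%:E = 1)%E ->
  exists (d : measure_display) (T : measurableType d)
      (P : probability T R) (X : nat -> T -> nat), is_walk c v0 P X.
Proof.
move=> p0 p1; exists _, (measurableTypeR R), (uniform_prob (@ltr01 R)).
exists (subdivision_walk (fun t => step_prob (c t)) v0).
exact: (subdivision_walk_law v0 p0 p1).
Qed.

(** * The conductances and their row sums *)

Section network.
Context (R : realType).

Definition star_tail (z : nat) : R := 16^-1 ^+ z.+1.

(* Defined as a difference so that the tail sums of [star] are [star_tail]. *)
Definition star (z : nat) : R := star_tail z - star_tail z.+1.

Fixpoint ray (k : nat) : R := if k is j.+1 then 2 * 4 ^+ j.+2 * ray j else 1.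
(** The factors [64 ^ k] here and in [loop] make both dangerous moves rare while trap [k] is alive:
    passing from the [k]-th ray vertex to the next one, and leaving the trap, each have probability
    at most [64 ^- k]. *)
Definition rung (k : nat) : R := 2 * 64 ^+ k * ray k.
Definition loop (k : nat) : R := 64 ^+ k * rung k.

(* The vertex [k.*2] is the [k]-th vertex of the ray and [k.*2.+1] is the trap
   hanging from it; [alive k] says whether the rung between the two and the loop
   at the trap are present. *)
Definition half_cond (alive : pred nat) (x y : nat) : R :=
  (x == 0%N)%:R * star y
  + (~~ odd x && (y == x.+2))%:R * ray x./2
  + [&& ~~ odd x, y == x.+1 & alive x./2]%:R * rung x./2
  + [&& odd x, y == x & alive x./2]%:R * loop x./2.

(** Symmetrising doubles the diagonal: the loop at a live trap has conductance [2 * loop k] beside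
    its star edges, and the one at the origin has [2 * star 0]. *)
Definition cond (alive : pred nat) (x y : nat) : R :=
  half_cond alive x y + half_cond alive y x.

Lemma star_tail_gt0 z : 0 < star_tail z.
Proof. by rewrite exprn_gt0// invr_gt0. Qed.

Lemma star_tailS z : star_tail z.+1 = star_tail z / 16.
Proof. by rewrite /star_tail exprSr. Qed.

Lemma star_gt0 z : 0 < star z.
Proof. by rewrite /star star_tailS; have := star_tail_gt0 z; lra. Qed.

Lemma star_le z : star z <= star_tail z.
Proof. by rewrite gerBl ltW// star_tail_gt0. Qed.

Lemma expn_ge1 (m k : nat) : 1 <= m.+1%:R ^+ k :> R.
Proof. by rewrite exprn_ege1// ler1n. Qed.

Lemma ray_ge1 k : 1 <= ray k.
Proof. by elim: k => //= k IH; have := expn_ge1 3 k.+2; nra. Qed.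

Lemma ray_growth k : 32 * ray k <= ray k.+1.
Proof.
have W := ray_ge1 k.
rewrite /= ler_wpM2r ?(le_trans ler01 W)// !exprS.
by have := expn_ge1 3 k; lra.
Qed.

Lemma rung_ge1 k : 1 <= rung k.
Proof. by rewrite /rung; have := expn_ge1 63 k; have := ray_ge1 k; nra. Qed.

Lemma loop_ge1 k : 1 <= loop k.
Proof. by rewrite /loop; have := expn_ge1 63 k; have := rung_ge1 k; nra. Qed.

Lemma half_cond_ge0 alive x y : 0 <= half_cond alive x y.
Proof.
have [s0 r0] := (ltW (star_gt0 y), le_trans ler01 (ray_ge1 x./2)).
have [q0 l0] := (le_trans ler01 (rung_ge1 x./2), le_trans ler01 (loop_ge1 x./2)).
by rewrite /half_cond !addr_ge0// mulr_ge0.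
Qed.

Lemma cond_ge0 alive x y : 0 <= cond alive x y.
Proof. by rewrite addr_ge0// half_cond_ge0. Qed.

Lemma condC alive x y : cond alive x y = cond alive y x.
Proof. by rewrite /cond addrC. Qed.

Lemma cond_network alive : is_network (cond alive).
Proof. by split => x y; [exact: cond_ge0|exact: condC]. Qed.

Lemma cond0_ge alive x : star x <= cond alive 0 x.
Proof.
have [r0 q0] := (le_trans ler01 (ray_ge1 0), le_trans ler01 (rung_ge1 0)).
have l0 := le_trans ler01 (loop_ge1 0).
have := half_cond_ge0 alive x 0; suff : star x <= half_cond alive 0 x.
  by rewrite /cond; lra.
rewrite /half_cond eqxx mul1r; move: (star x) => s; rewrite -!addrA lerDl.
by do ![apply: addr_ge0]; apply: mulr_ge0.
Qed.

Lemma cond_connected alive : connected_network (cond alive).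
Proof.
move=> x y; exists [:: 0%N; y] => //=.
have pos z : 0 < cond alive 0 z by apply: lt_le_trans (cond0_ge alive z); exact: star_gt0.
by rewrite condC !pos.
Qed.

Lemma nneseries_points (s : seq (nat * R)) (u g : nat -> R) :
  (forall i, i \in s -> 0 <= i.2) -> (forall y, 0 <= g y) ->
  (forall y, u y = \sum_(i <- s) (y == i.1)%:R * i.2) ->
  (\sum_(y <oo) (u y * g y)%:E = (\sum_(i <- s) i.2 * g i.1)%:E)%E.
Proof.
move=> s0 g0 uE.
transitivity (\sum_(y <oo) \sum_(i <- s | i \in s) ((y == i.1)%:R * i.2 * g y)%:E)%E.
  apply: eq_eseriesr => y _; rewrite uE mulr_suml sumEFin; congr (_%:E).
  by rewrite [LHS]big_seq.
rewrite nneseries_sum; last by move=> i y /s0 i0; rewrite lee_fin !mulr_ge0.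
rewrite -sumEFin [RHS]big_seq; apply: eq_bigr => i /s0 i0.
rewrite (nneseriesD1 (n := i.1))//; last by move=> y _; rewrite lee_fin !mulr_ge0.
rewrite eqxx mul1r eseries0 ?adde0// => y _ /negPf ->.
by rewrite !mul0r.
Qed.

(** The partial sums of [star] from [N] on telescope; [maxn n N] in the induction accounts for the
    vanishing terms below [N]. *)
Lemma star_sum_le (g : nat -> R) (C : R) N : 0 <= C -> (forall y, 0 <= g y) ->
  (forall y, g y <= C * (N <= y)%:R) ->
  (\sum_(y <oo) (star y * g y)%:E <= (C * star_tail N)%:E)%E.
Proof.
move=> C0 g0 gC; apply: lime_le.
  apply: is_cvg_nneseries => y _ _.
  by rewrite lee_fin mulr_ge0// ltW// star_gt0.
apply: nearW => n; rewrite sumEFin lee_fin.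
suff : \sum_(0 <= y < n) star y * g y <= C * (star_tail N - star_tail (maxn n N)).
  move=> /le_trans; apply; rewrite ler_wpM2l// gerBl ltW// star_tail_gt0//.
elim: n => [|n IH]; first by rewrite big_geq// max0n subrr mulr0.
rewrite big_nat_recr//=; have [Nn|nN] := leqP N n.
  rewrite (maxn_idPl (leqW Nn)); rewrite (maxn_idPl Nn) in IH.
  apply: (le_trans (lerD IH (_ : _ <= star n * C))).
    rewrite ler_wpM2l ?(ltW (star_gt0 n))// (le_trans (gC n))//.
    by rewrite Nn mulr1.
  by rewrite /star; lra.
rewrite (maxn_idPr nN); rewrite (maxn_idPr (ltnW nN)) in IH.
suff -> : g n = 0 by rewrite mulr0 addr0.
by apply/eqP; rewrite eq_le g0 andbT; have := gC n; rewrite leqNgt nN mulr0.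
Qed.

Section rows.
Variable alive : pred nat.
Hypothesis alive0 : alive 0%N = false.

Lemma row0 (g : nat -> R) : (forall y, 0 <= g y) ->
  (\sum_(y <oo) (cond alive 0 y * g y)%:E =
   \sum_(y <oo) (star y * g y)%:E + (ray 0 * g 2 + star 0 * g 0)%:E)%E.
Proof.
move=> g0; have s0 y : 0 <= star y by rewrite ltW// star_gt0.
pose u y : R := \sum_(i <- [:: (2%N, ray 0); (0%N, star 0)]) (y == i.1)%:R * i.2.
transitivity (\sum_(y <oo) ((star y * g y)%:E + (u y * g y)%:E))%E.
  apply: eq_eseriesr => y _; rewrite -EFinD -mulrDl; congr (_ * _)%:E.
  rewrite /cond /half_cond /u !big_cons big_nil /= alive0 !andbF.
  have -> : [&& odd y, 0%N == y & alive y./2] = false.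
    by case: y => // y; rewrite andbF.
  by rewrite !mul0r; ring.
rewrite nneseriesD.
- congr (_ + _)%E; rewrite (nneseries_points (s := [:: (2%N, ray 0); (0%N, star 0)]))//.
    by rewrite !big_cons big_nil addr0.
  by move=> i; rewrite !inE => /orP[] /eqP -> //=.
- by move=> y _ _; rewrite lee_fin mulr_ge0.
- move=> y _ _; rewrite lee_fin mulr_ge0// /u !big_cons big_nil addr0/=.
  by rewrite addr_ge0// mulr_ge0.
Qed.

Lemma row_even k (g : nat -> R) : (forall y, 0 <= g y) ->
  let x := k.+1.*2 in
  (\sum_(y <oo) (cond alive x y * g y)%:E =
   (ray k.+1 * g x.+2 + (alive k.+1)%:R * rung k.+1 * g x.+1 +
    star x * g 0 + ray k * g k.*2)%:E)%E.
Proof.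
move=> g0 x; have s0 y : 0 <= star y by rewrite ltW// star_gt0.
have r0 j : 0 <= ray j := le_trans ler01 (ray_ge1 j).
have q0 j : 0 <= rung j := le_trans ler01 (rung_ge1 j).
(* For [k = 0] the last two entries are both at the origin; [nneseries_points] adds the weights of
   repeated points. *)
pose s := [:: (x.+2, ray k.+1); (x.+1, (alive k.+1)%:R * rung k.+1);
  (0%N, star x); (k.*2, ray k)].
rewrite (nneseries_points (s := s))//; first by rewrite !big_cons big_nil addr0/= !addrA.
  by move=> i; rewrite !inE => /or4P[] /eqP -> //=; rewrite mulr_ge0.
move=> y; rewrite !big_cons big_nil addr0 /= /cond /half_cond.
have ox : odd x = false by rewrite /x odd_double.
have hx : x./2 = k.+1 by rewrite /x doubleK.
have -> : (x == 0%N) = false by rewrite /x.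
rewrite ox hx /= !mul0r !add0r addr0.
have -> : (~~ odd y && (x == y.+2)) = (y == k.*2).
  by rewrite /x doubleS !eqSS eq_sym; case: eqVneq => [->|]; rewrite ?odd_double ?andbF.
have -> : [&& ~~ odd y, x == y.+1 & alive y./2] = false.
  by case: eqVneq => [xy|]; rewrite ?andbF//; move: ox; rewrite xy /= => /negbFE ->.
have -> : [&& odd y, x == y & alive y./2] = false.
  by case: eqVneq => [xy|]; rewrite ?andbF//; rewrite -xy ox.
have -> : (y == k.*2)%:R * ray y./2 = (y == k.*2)%:R * ray k.
  by case: eqVneq => [->|_]; rewrite ?mul0r// doubleK.
by rewrite !mul0r -mulnb natrM; ring.
Qed.

Lemma row_odd k (g : nat -> R) : (forall y, 0 <= g y) ->
  let x := k.*2.+1 in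
  (\sum_(y <oo) (cond alive x y * g y)%:E =
   ((alive k)%:R * (2 * loop k * g x + rung k * g k.*2) + star x * g 0)%:E)%E.
Proof.
move=> g0 x; have s0 y : 0 <= star y by rewrite ltW// star_gt0.
have l0 j : 0 <= loop j := le_trans ler01 (loop_ge1 j).
have q0 j : 0 <= rung j := le_trans ler01 (rung_ge1 j).
pose s := [:: (x, (alive k)%:R * (2 * loop k)); (k.*2, (alive k)%:R * rung k);
  (0%N, star x)].
rewrite (nneseries_points (s := s))//.
- by rewrite !big_cons big_nil addr0/= addrA mulrDr !mulrA.
- by move=> i; rewrite !inE => /or3P[] /eqP -> //=; do ?[apply: mulr_ge0 => //].
move=> y; rewrite !big_cons big_nil addr0 /= /cond /half_cond.
have ox : odd x by rewrite /x /= odd_double.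
have hx : x./2 = k by rewrite /x /= uphalf_double.
rewrite ox hx /= !mul0r !add0r.
have -> : (~~ odd y && (x == y.+2)) = false.
  by case: eqVneq => [xy|]; rewrite ?andbF//; move: ox; rewrite xy /= negbK => ->.
have -> : [&& ~~ odd y, x == y.+1 & alive y./2] = (y == k.*2) && alive k.
  rewrite /x eqSS eq_sym; case: eqVneq => [->|]; rewrite ?andbF//.
  by rewrite odd_double doubleK.
have -> : [&& odd y, x == y & alive y./2] = (y == x) && alive k.
  by rewrite eq_sym; case: eqVneq => [->|]; rewrite ?andbF// ox hx.
rewrite mul0r addr0 -!mulnb !natrM.
have -> : (y == k.*2)%:R * (alive k)%:R * rung y./2 =
    (y == k.*2)%:R * ((alive k)%:R * rung k).
  by case: eqVneq => [->|_]; rewrite ?mul0r// doubleK mulrA.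
have -> : (y == x)%:R * (alive k)%:R * loop y./2 =
    (y == x)%:R * (alive k)%:R * loop k.
  by case: eqVneq => [->|_]; rewrite ?mul0r// hx.
ring.
Qed.
End rows.
End network.

Lemma vertex_ind (P : nat -> Prop) :
  P 0%N -> (forall k, P k.+1.*2) -> (forall k, P k.*2.+1) -> forall x, P x.
Proof.
move=> P0 Pe Po x; rewrite -(odd_double_half x).
by case: (odd x) => //=; case: x./2.
Qed.

(** * Transition probabilities and transience of a frozen network *)

Section steps.
Context (R : realType) (alive : pred nat).
Hypothesis alive0 : alive 0%N = false.
Local Notation c := (@cond R alive).
Local Notation p := (step_prob c).

Lemma total_condE x :
  total_conductance c x = (\sum_(y <oo) (c x y * 1)%:E)%E.
Proof.
rewrite /total_conductance -nneseries_esumT.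
  by apply: eq_eseriesr => y _; rewrite mulr1.
by move=> y; rewrite lee_fin cond_ge0.
Qed.

Lemma total_even k : let x := k.+1.*2 in
  total_conductance c x =
  (ray R k.+1 + (alive k.+1)%:R * rung R k.+1 + star R x + ray R k)%:E.
Proof. by rewrite /= total_condE (@row_even R alive k (fun=> 1))// !mulr1. Qed.

Lemma total_odd k : let x := k.*2.+1 in
  total_conductance c x =
  ((alive k)%:R * (2 * loop R k + rung R k) + star R x)%:E.
Proof. by rewrite /= total_condE (@row_odd R alive k (fun=> 1))// !mulr1. Qed.

Lemma star_total_ge0 : (0 <= \sum_(y <oo) (star R y * 1)%:E)%E.
Proof. by apply: nneseries_ge0 => y _ _; rewrite mulr1 lee_fin ltW// star_gt0. Qed.

Lemma total_fin x : total_conductance c x \is a fin_num.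
Proof.
move: x; apply: vertex_ind => [|k|k]; rewrite ?total_even ?total_odd//.
rewrite total_condE (@row0 R alive alive0 (fun=> 1))// fin_numD andbT.
have := @star_sum_le R (fun=> 1) 1 0 ler01 (fun=> ler01).
by move=> /(_ (fun _ => _)) h; rewrite ge0_fin_numE ?star_total_ge0//
  (le_lt_trans (h _)) ?ltry// => y; rewrite mul1r.
Qed.

Lemma cond_locally_finite : locally_finite c.
Proof. by move=> x; have := total_fin x; rewrite fin_numE -ltey => /andP[]. Qed.

Lemma total0_ge : 1 + star R 0 <= fine (total_conductance c 0%N).
Proof.
rewrite -lee_fin fineK ?total_fin// total_condE (@row0 R alive alive0 (fun=> 1))//.
by rewrite !mulr1 leeDr// star_total_ge0.
Qed.

Lemma total_gt0 x : 0 < fine (total_conductance c x).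
Proof.
move: x; apply: vertex_ind => [|k|k].
- by apply: lt_le_trans total0_ge; rewrite addr_gt0// star_gt0.
- rewrite total_even /=.
  have := ray_ge1 R k.+1; have := ray_ge1 R k; have := rung_ge1 R k.+1.
  by have := star_gt0 R k.+1.*2; case: (alive k.+1) => /=; lra.
- rewrite total_odd /=; have := loop_ge1 R k; have := rung_ge1 R k.
  by have := star_gt0 R k.*2.+1; case: (alive k) => /=; lra.
Qed.

Lemma step_ge0 x z : 0 <= p x z.
Proof. by rewrite divr_ge0 ?cond_ge0// ltW// total_gt0. Qed.

Lemma step_sumE x (g : nat -> R) : (forall y, 0 <= g y) ->
  (\sum_(z <oo) (p x z * g z)%:E =
   (fine (total_conductance c x))^-1%:E * \sum_(z <oo) (c x z * g z)%:E)%E.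
Proof.
move=> g0; rewrite -nneseriesZl; last by move=> z _; rewrite lee_fin mulr_ge0// cond_ge0.
by apply: eq_eseriesr => z _; rewrite -EFinM mulrA /step_prob [_^-1 * _]mulrC.
Qed.

Lemma step_sum1 x : (\sum_(z <oo) (p x z)%:E = 1)%E.
Proof.
have := @step_sumE x (fun=> 1) (fun=> ler01).
rewrite -total_condE -[X in (_ * X)%E]fineK ?total_fin// -EFinM.
rewrite mulVf ?gt_eqF ?total_gt0//.
by under eq_eseriesr do rewrite mulr1.
Qed.

Lemma step_sum_le1 x (g : nat -> R) (h : R) : (forall y, 0 <= g y) ->
  (forall y, g y <= h) -> (\sum_(z <oo) (p x z * g z)%:E <= h%:E)%E.
Proof.
move=> g0 gh; have h0 : 0 <= h := le_trans (g0 0) (gh 0).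
apply: (@le_trans _ _ (\sum_(z <oo) h%:E * (p x z)%:E)%E).
  apply: lee_nneseries => [z _ _|z _]; first by rewrite lee_fin mulr_ge0// step_ge0.
  by rewrite -EFinM lee_fin mulrC ler_wpM2r// step_ge0.
by rewrite nneseriesZl ?step_sum1 ?mule1// => z _; rewrite lee_fin step_ge0.
Qed.

Lemma step_sum_le x (g : nat -> R) (h : R) : (forall y, 0 <= g y) ->
  (\sum_(z <oo) (c x z * g z)%:E <= (h * fine (total_conductance c x))%:E)%E ->
  (\sum_(z <oo) (p x z * g z)%:E <= h%:E)%E.
Proof.
move=> g0 gh; rewrite step_sumE//.
have t0 := total_gt0 x; have ti0 : 0 <= (fine (total_conductance c x))^-1.
  by rewrite invr_ge0 ltW.
apply: (le_trans (lee_wpmul2l _ gh)); first by rewrite lee_fin.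
by rewrite -EFinM lee_fin mulrC mulfK// gt_eqF.
Qed.

(** The origin is the one vertex with infinitely many neighbours, so its star edges are handled by a
    uniform bound: [N = 0] for bounded functions, large [N] for indicators of far vertices. *)
Lemma step0_le (g : nat -> R) (C h : R) N : (forall y, 0 <= g y) -> 0 <= C ->
  (forall y, g y <= C * (N <= y)%:R) -> 0 <= h ->
  C * star_tail R N + g 2%N + star R 0 * g 0%N <= h * (1 + star R 0) ->
  (\sum_(z <oo) (p 0%N z * g z)%:E <= h%:E)%E.
Proof.
move=> g0 C0 gC h0 gh; apply: step_sum_le => //; rewrite row0//.
apply: (le_trans (leeD (star_sum_le C0 g0 gC) (le_refl _))).
rewrite -EFinD lee_fin /= mul1r addrA; apply: (le_trans gh).
by rewrite ler_wpM2l// total0_ge.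
Qed.

Lemma step_even_le k (g : nat -> R) (h : R) : let x := k.+1.*2 in
  (forall y, 0 <= g y) ->
  ray R k.+1 * g x.+2 + (alive k.+1)%:R * rung R k.+1 * g x.+1 +
    star R x * g 0%N + ray R k * g k.*2 <=
  h * (ray R k.+1 + (alive k.+1)%:R * rung R k.+1 + star R x + ray R k) ->
  (\sum_(z <oo) (p x z * g z)%:E <= h%:E)%E.
Proof.
move=> x g0 gh; apply: step_sum_le => //; rewrite row_even//.
by rewrite total_even lee_fin.
Qed.

Lemma step_odd_le k (g : nat -> R) (h : R) : let x := k.*2.+1 in
  (forall y, 0 <= g y) ->
  (alive k)%:R * (2 * loop R k * g x + rung R k * g k.*2) + star R x * g 0%N <=
  h * ((alive k)%:R * (2 * loop R k + rung R k) + star R x) ->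
  (\sum_(z <oo) (p x z * g z)%:E <= h%:E)%E.
Proof.
move=> x g0 gh; apply: step_sum_le => //; rewrite row_odd//.
by rewrite total_odd lee_fin.
Qed.

Lemma cond_walk_exists v : exists (d : measure_display) (T : measurableType d)
  (P : probability T R) (X : nat -> T -> nat), is_walk (fun=> c) v P X.
Proof. by apply: walk_exists => *; [exact: step_ge0|exact: step_sum1]. Qed.

(* Positive and superharmonic, with no local minimum: a trap lies above its foot
   on the ray while it is alive, and above the origin once it is dead. *)
Definition potential (x : nat) : R :=
  if x == 0%N then 1
  else if odd x then
    if alive x./2 then 4^-1 ^+ x./2 + star R x / rung R x./2 else 2
  else 4^-1 ^+ x./2.

Lemma potential_even k : potential k.*2 = 4^-1 ^+ k.
Proof. by rewrite /potential odd_double doubleK; case: k. Qed.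

Lemma potential_odd k : potential k.*2.+1 =
  if alive k then 4^-1 ^+ k + star R k.*2.+1 / rung R k else 2.
Proof. by rewrite /potential /= odd_double uphalf_double. Qed.

Lemma star_le1 z : star R z <= 1.
Proof.
apply: (le_trans (star_le R z)); rewrite exprn_ile1//.
by rewrite invf_le1// ler1n.
Qed.

Lemma star_rung z k : 0 < star R z / rung R k <= 1.
Proof.
have r0 : 0 < rung R k by apply: lt_le_trans (rung_ge1 R k).
rewrite divr_gt0// ?star_gt0//= ler_pdivrMr// mul1r.
exact: le_trans (star_le1 z) (rung_ge1 R k).
Qed.

Lemma expV4 k : 0 < (4^-1 : R) ^+ k <= 1.
Proof. by rewrite exprn_gt0 ?invr_gt0//= exprn_ile1// invf_le1// ler1n. Qed.

Lemma potential_gt0 x : 0 < potential x.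
Proof.
move: x; apply: vertex_ind => [|k|k].
- exact: ltr01.
- by rewrite potential_even; have /andP[] := expV4 k.+1.
- rewrite potential_odd; have /andP[h _] := expV4 k.
  have /andP[h' _] := star_rung k.*2.+1 k.
  by case: ifP => // _; exact: addr_gt0.
Qed.

Lemma potential_le2 x : potential x <= 2.
Proof.
move: x; apply: vertex_ind => [|k|k].
- by rewrite /potential /=; lra.
- by rewrite potential_even; have /andP[_ h] := expV4 k.+1; lra.
- rewrite potential_odd; have /andP[_ h] := expV4 k.
  have /andP[_ h'] := star_rung k.*2.+1 k.
  by case: ifP => // _; rewrite -[2]/(1 + 1) lerD.
Qed.

Lemma star_le_expV4 z k : (k <= z)%N -> star R z <= 4^-1 ^+ k.
Proof.
move=> kz; apply: (le_trans (star_le R z)).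
rewrite /star_tail !exprVn lef_pV2 ?posrE ?exprn_gt0//.
apply: (@le_trans _ _ (4 ^+ z.+1)).
  by apply: ler_weXn2l; [rewrite ler1n|exact: leqW].
by apply: lerXn2r; rewrite ?nnegrE// ler_nat.
Qed.

(** On the ray the fourfold decrease ahead outweighs the increase behind, because
    [ray k.+1 >= 32 * ray k]. A live trap exceeds its foot by [star / rung]: seen from the foot this
    costs only one [star] conductance, and seen from the trap the drop along the rung pays for the
    edge to the origin. A dead trap drops from 2 to 1. *)
Lemma potential_superharmonic x :
  (\sum_(z <oo) (p x z * potential z)%:E <= (potential x)%:E)%E.
Proof.
have f0 y : 0 <= potential y by rewrite ltW// potential_gt0.
move: x; apply: vertex_ind => [|k|k].
- apply: (@step0_le _ 2 _ 0) => //.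
    by move=> y; rewrite mulr1 potential_le2.
  have -> : potential 2%N = 4^-1 by rewrite (potential_even 1).
  have -> : potential 0%N = 1 by [].
  by rewrite /star_tail expr1; lra.
- apply: step_even_le => //.
  rewrite -doubleS !potential_even potential_odd.
  have -> : potential 0%N = 1 by [].
  have /andP[u0 u1] := expV4 k.
  have W := ray_ge1 R k; have Q := rung_ge1 R k.+1.
  have s1 := @star_le_expV4 k.+1.*2 k.+1 (ltac:(lia)).
  have s2 := @star_le_expV4 k.+1.*2.+1 k.+1 (ltac:(lia)).
  have s0 := star_gt0 R k.+1.*2.
  have Qs : rung R k.+1 * (star R k.+1.*2.+1 / rung R k.+1) = star R k.+1.*2.+1.
    by rewrite mulrC mulfVK// gt_eqF// (lt_le_trans ltr01).
  have W1 := ray_growth R k.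
  move: s1 s2 Qs W1; rewrite !exprS.
  move: (4^-1 ^+ k) u0 u1 (ray R k.+1) (ray R k) W (rung R k.+1) Q s0 => u u0 u1.
  move: (star R k.+1.*2) (star R k.+1.*2.+1) => s s'.
  move=> W1 W W_ge1 Q Q_ge1 s0 su s'u Qs' W1W.
  have P1 : 32 * W * u <= W1 * u by rewrite ler_wpM2r// ltW.
  have P2 : u <= W * u by rewrite ler_peMl// ltW.
  have P3 : 0 <= u * s by rewrite mulr_ge0// ltW.
  case: (alive k.+1); last by rewrite !mul0r; nra.
  by rewrite mul1r mulrDr Qs'; nra.
- apply: step_odd_le => //.
  have -> : potential 0%N = 1 by [].
  rewrite potential_even potential_odd; have s0 := star_gt0 R k.*2.+1.
  case: (alive k); last by rewrite !mul0r; lra.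
  have /andP[u0 u1] := expV4 k; have Q := rung_ge1 R k.
  have /andP[r0 r1] := star_rung k.*2.+1 k.
  have Qs : rung R k * (star R k.*2.+1 / rung R k) = star R k.*2.+1.
    by rewrite mulrC mulfVK// gt_eqF// (lt_le_trans ltr01).
  move: u0 u1 r0 r1 Qs s0; move: (star R _) (_ / rung R k) => a r.
  move: ((4^-1 : R) ^+ k) (loop R k) (rung R k) Q => u L Q _ u0 _ r0 _ Qr a0.
  have P1 : 0 <= a * (u + r) by rewrite mulr_ge0 ?addr_ge0// ltW.
  suff -> : (u + r) * (1 * (2 * L + Q) + a) =
      1 * (2 * L * (u + r) + Q * u) + a * 1 + a * (u + r) by rewrite lerDl.
  by rewrite -{2}Qr; ring.
Qed.

Lemma step_gt0 x z : 0 < c x z -> 0 < p x z.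
Proof. by move=> cxz; rewrite divr_gt0// total_gt0. Qed.

(** The lower neighbour is the next vertex for the ray, the foot for a live trap and the origin for
    a dead one. *)
Lemma potential_descent v : exists2 z, 0 < p v z & potential z < potential v.
Proof.
have pos x z : 0 < half_cond R alive x z -> 0 < p x z.
  by move=> h; apply: step_gt0; rewrite ltr_pwDl// half_cond_ge0.
move: v; suff even k : exists2 z, 0 < p k.*2 z & potential z < potential k.*2.
  apply: vertex_ind => [|k|k]; [exact: (even 0%N)|exact: even|].
  case al : (alive k).
    exists k.*2; last first.
      rewrite potential_even potential_odd al.
      by case/andP: (star_rung k.*2.+1 k); lra.
    apply: step_gt0; rewrite condC ltr_pwDl ?half_cond_ge0//.
    rewrite /half_cond odd_double doubleK eqxx al /= mul1r.
    have := star_gt0 R k.*2.+1; have := rung_ge1 R k => Q s.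
    by rewrite -!addrA ltr_wpDl ?mulr_ge0 ?(ltW s)// ltr_wpDl ?mulr_ge0 ?ray_ge1
      ?(le_trans ler01 (ray_ge1 _ _))// mul0r addr0 (lt_le_trans ltr01 Q).
  exists 0%N; last by rewrite potential_odd al /potential /=; lra.
  apply: step_gt0; rewrite condC; apply: lt_le_trans (cond0_ge _ _ _).
  exact: star_gt0.
exists k.+1.*2; last first.
  by rewrite !potential_even exprS; case/andP: (expV4 k); lra.
apply: pos; rewrite /half_cond odd_double doubleK doubleS eqxx /= mul1r.
rewrite -!addrA; have s := star_gt0 R k.*2.+2; have W := ray_ge1 R k.
have -> : (k.*2.+2 == k.*2.+1) = false by apply: gtn_eqF.
by rewrite !mul0r !addr0 ltr_wpDl ?mulr_ge0 ?(ltW s)// (lt_le_trans ltr01 W).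
Qed.

Lemma cond_transient : transient c.
Proof.
move=> v; have [d [T [P [X Xc]]]] := cond_walk_exists v.
exists d, T, P, X; split => //; have [z pz fz] := potential_descent v.
exact: (superharmonic_no_return step_ge0 step_sum1 potential_gt0
  potential_superharmonic pz fz Xc).
Qed.
End steps.

(** * One-step estimates during a stage *)

Section stages.
Context (R : realType).

(* A Lyapunov function for stage [n], when the traps below [n] are dead and trap
   [n] is alive: it halves in mean at each step, up to the small probability of
   escaping past [n.*2.+1], and it vanishes only at trap [n]. *)
Definition drift (n x : nat) : R :=
  if (n.*2.+1 < x)%N then 2 * 4 ^+ n
  else if x == n.*2.+1 then 0
  else if odd x then 2 * 4 ^+ n
  else 4 ^+ (n - x./2).

Lemma drift_out n x : (n.*2.+1 < x)%N -> drift n x = 2 * 4 ^+ n.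
Proof. by rewrite /drift => ->. Qed.

Lemma drift_even n k : (k <= n)%N -> drift n k.*2 = 4 ^+ (n - k).
Proof.
move=> kn; rewrite /drift ltnNge ltnW ?ltnS ?leq_double//= odd_double doubleK.
by case: eqVneq => // /(congr1 odd); rewrite /= !odd_double.
Qed.

Lemma drift_odd n k : (k < n)%N -> drift n k.*2.+1 = 2 * 4 ^+ n.
Proof.
move=> kn; rewrite /drift ltnS ltn_double ltnNge (ltnW kn)/= eqSS odd_double /=.
by rewrite -!muln2 eqn_mul2r /= ltn_eqF.
Qed.

Lemma drift_trap n : drift n n.*2.+1 = 0.
Proof. by rewrite /drift ltnn eqxx. Qed.

Lemma drift_ge0 n x : 0 <= drift n x.
Proof.
by rewrite /drift; case: ifP => _; [|case: ifP => _; [|case: ifP => _]];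
  rewrite ?mulr_ge0 ?exprn_ge0.
Qed.

Lemma drift_le n x : drift n x <= 2 * 4 ^+ n.
Proof.
have h : 1 <= 4 ^+ n :> R := expn_ge1 R 3 n.
have hk : 4 ^+ (n - x./2) <= 4 ^+ n :> R.
  by apply: ler_weXn2l; [rewrite ler1n|exact: leq_subr].
by rewrite /drift; case: ifP => _; [|case: ifP => _; [|case: ifP => _]]; lra.
Qed.

Lemma drift_ge n x : (x != n.*2.+1)%:R <= drift n x.
Proof.
have h : 1 <= 4 ^+ n :> R := expn_ge1 R 3 n.
rewrite /drift; case: ifP => [xn|_]; first by case: (_ != _) => /=; lra.
case: eqVneq => //= _; case: ifP => _; first by lra.
exact: (expn_ge1 R 3).
Qed.

Variable alive : pred nat.
Hypothesis alive0 : alive 0%N = false.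
Local Notation p := (step_prob (@cond R alive)).
Variable n : nat.
Hypothesis n_gt0 : (0 < n)%N.
Let delta : R := (64 ^+ n)^-1.
Let delta_gt0 : 0 < delta.
Proof. by rewrite invr_gt0 exprn_gt0. Qed.

Lemma star_mul_le1 z k : (k <= z)%N -> star R z * 4 ^+ k <= 1.
Proof.
move=> kz; apply: (le_trans (ler_wpM2r _ (@star_le_expV4 R _ _ kz))).
  by rewrite exprn_ge0.
by rewrite -exprMn mulVf ?expr1n// pnatr_eq0.
Qed.

(** Only two moves lead past [n.*2.+1] from below: a star edge from the origin, of total weight at
    most [16 ^- (2 n + 3)], and the ray edge at the [n]-th vertex, which the live rung dominates. *)
Lemma exit_step : alive n -> forall x,
  (\sum_(z <oo) (p x z * (n.*2.+1 < z)%N%:R)%:E <=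
   ((n.*2.+1 < x)%N%:R + delta)%:E)%E.
Proof.
move=> alive_n x.
have [xn|nx] := boolP (n.*2.+1 < x)%N.
  apply: (step_sum_le1 alive0) => // y; have := delta_gt0; case: (_ < _)%N => /=; lra.
rewrite add0r; move: x nx; apply: vertex_ind => [_|k|k].
- apply: (@step0_le _ _ _ _ 1 _ n.*2.+2) => //.
  + by move=> y; rewrite mul1r.
  + exact: ltW.
  rewrite (_ : (n.*2.+1 < 2)%N = false); last by apply/negbTE; lia.
  rewrite mulr0 !addr0 mul1r mulrDr mulr1 (@le_trans _ _ delta)//.
    rewrite /star_tail exprVn lef_pV2 ?posrE ?exprn_gt0//.
    apply: (@le_trans _ _ (16 ^+ n.*2)); last first.
      by apply: ler_weXn2l; [rewrite ler1n|lia].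
    by rewrite -mul2n exprM; apply: lerXn2r; rewrite ?nnegrE ?exprn_ge0// expr2; lra.
  by rewrite lerDl mulr_ge0// ltW// star_gt0.
- rewrite -leqNgt => kn; apply: (step_even_le alive0) => //.
  rewrite (_ : (_ < k.+1.*2.+1)%N = false); last by apply/negbTE; lia.
  rewrite (_ : (_ < 0)%N = false)// (_ : (_ < k.*2)%N = false); last first.
    by apply/negbTE; lia.
  have Q := rung_ge1 R k.+1; have W := ray_ge1 R k; have W1 := ray_ge1 R k.+1.
  have s := star_gt0 R k.+1.*2; have d := delta_gt0.
  rewrite !mulr0 !addr0; have [kn'|kn'] := eqVneq k.+1 n.
    rewrite kn' alive_n mul1r ltnSn mulr1; rewrite kn' in W1 s.
    move: (star R _) s => a a0.
    have QE : delta * rung R n = 2 * ray R n.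
      by rewrite /rung mulrA mulrCA mulVf ?mulr1// gt_eqF// exprn_gt0.
    have dW : 0 <= delta * ray R n by rewrite mulr_ge0 ?ltW// (lt_le_trans ltr01).
    have ds : 0 <= delta * a by rewrite mulr_ge0 ?ltW.
    have dW' : 0 <= delta * ray R k by rewrite mulr_ge0 ?ltW// (lt_le_trans ltr01).
    by rewrite !mulrDr QE; lra.
  rewrite (_ : (_ < k.+1.*2.+2)%N = false); last by apply/negbTE; lia.
  rewrite mulr0 mulr_ge0 ?ltW// addr_gt0 ?(lt_le_trans ltr01 W)//.
  rewrite ltr_wpDl ?(ltW s)//; case: (alive _); rewrite ?mul0r ?mul1r; lra.
- rewrite -leqNgt => kn; apply: (step_odd_le alive0) => //.
  rewrite (_ : (_ < k.*2.+1)%N = false); last by apply/negbTE; lia.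
  rewrite (_ : (_ < 0)%N = false)// (_ : (_ < k.*2)%N = false); last first.
    by apply/negbTE; lia.
  have Q := rung_ge1 R k; have L := loop_ge1 R k.
  have s := star_gt0 R k.*2.+1; have d := delta_gt0.
  rewrite !mulr0 !addr0 !mulr0 mulr_ge0 ?ltW//.
  by case: (alive _); rewrite ?mul0r ?mul1r; lra.
Qed.

(** Below level [n] a ray vertex mostly moves up, dividing the value by 4, and a dead trap goes from
    [2 * 4 ^ n] to exactly half of it at the origin. The [n]-th ray vertex mostly falls into the
    trap, where the value is 0; the [delta] term pays for passing or leaving it, and the last term
    for being already past it. *)
Lemma drift_step : alive n -> (forall j, (j < n)%N -> alive j = false) ->
  forall x,
  (\sum_(z <oo) (p x z * drift n z)%:E <=
   (2^-1 * drift n x + 2 * 4 ^+ n * delta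
    + 2 * 4 ^+ n * (n.*2.+1 < x)%N%:R)%:E)%E.
Proof.
move=> alive_n alive_lt x.
have F : 1 <= 4 ^+ n :> R := expn_ge1 R 3 n.
have Md : 0 <= 2 * 4 ^+ n * delta.
  by rewrite mulr_ge0 ?(ltW delta_gt0)// mulr_ge0// (le_trans ler01).
have [xn|nx] := boolP (n.*2.+1 < x)%N.
  apply: (step_sum_le1 alive0) => [y|y]; first exact: drift_ge0.
  rewrite mulr1; apply: (le_trans (drift_le n y)).
  by have := drift_ge0 n x; lra.
rewrite mulr0 addr0; move: x nx; apply: vertex_ind => [_|k|k].
- have -> : drift n 0 = 4 ^+ n by rewrite (drift_even (leq0n n)) subn0.
  apply: (@step0_le _ _ alive0 _ (2 * 4 ^+ n) _ 0).
  + exact: drift_ge0.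
  + by lra.
  + by move=> y; rewrite mulr1 drift_le.
  + by lra.
  have -> : drift n 0 = 4 ^+ n by rewrite (drift_even (leq0n n)) subn0.
  have -> : drift n 2 = 4 ^+ n.-1 by rewrite (drift_even n_gt0) subn1.
  have E : 4 ^+ n = 4 * 4 ^+ n.-1 :> R by rewrite -exprS prednK.
  rewrite /star /star_tail expr1 expr2; move: Md F; rewrite E.
  by move: (4 ^+ n.-1) (_ * delta) => u Md Md0 F; lra.
- rewrite -leqNgt => kn; apply: (step_even_le alive0); first exact: drift_ge0.
  have kn' : (k < n)%N by lia.
  have Q := rung_ge1 R k.+1; have W := ray_ge1 R k; have W1 := ray_growth R k.
  have s := star_gt0 R k.+1.*2; have d := delta_gt0.
  rewrite -(doubleS k.+1) (drift_even kn') (drift_even (ltnW kn')).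
  rewrite (drift_even (leq0n n)) subn0.
  move: kn'; rewrite leq_eqVlt => /predU1P[kn'|kn'].
    rewrite kn' alive_n drift_trap drift_out; last by lia.
    have -> : (n - k = 1)%N by lia.
    rewrite subnn expr0 expr1 mul1r mulr0 addr0 mulr1.
    have s4 : star R n.*2 * 4 ^+ n <= 1 by apply: star_mul_le1; lia.
    rewrite kn' in Q W1 s.
    have QE : delta * rung R n = 2 * ray R n.
      rewrite /rung mulrA mulrCA mulVf ?mulr1// gt_eqF// exprn_gt0.
    have RQ : 128 * ray R n <= rung R n.
      rewrite /rung ler_wpM2r ?(le_trans ler01 (ray_ge1 R n))//.
      rewrite -(prednK n_gt0) exprS.
      by have := @expn_ge1 R 63 n.-1; lra.
    have n0 := ray_ge1 R n; move: Md QE F s4 W1 s RQ Q {kn}.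
    move: (ray R n) n0 (ray R k) W (rung R n) (star R _) (4 ^+ n).
    move=> W1 W1_ge1 W W_ge1 Q a f Md QE F s4 W1W a0 RQ _.
    have eQ : 2 * f * delta * Q = 4 * f * W1 by rewrite -mulrA QE; ring.
    have e0 : 0 <= 2 * f * delta * (W1 + a + W).
      by rewrite mulr_ge0//; lra.
    by move: e0 eQ Md; move: (2 * f * delta) => e e0 eQ Md; nra.
  (* Strictly below level [n] the values behind, here and ahead are [16 * 4 ^ r], [4 * 4 ^ r] and
     [4 ^ r]; ray growth makes the backward edge affordable. *)
  have [r rE] : exists r, n = (r + k.+2)%N by exists (n - k.+2)%N; lia.
  rewrite (alive_lt _ kn') !mul0r addr0 (drift_even kn').
  have -> : (n - k.+2 = r)%N by lia.
  have -> : (n - k.+1 = r.+1)%N by lia.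
  have -> : (n - k = r.+2)%N by lia.
  have s4 : star R k.+1.*2 * 4 ^+ k.+2 <= 1 by apply: star_mul_le1; lia.
  move: Md; have -> : 4 ^+ n = 4 ^+ r * 4 ^+ k.+2 :> R by rewrite rE exprD.
  have r1 := expn_ge1 R 3 r.
  rewrite [4 ^+ r.+2]exprS [4 ^+ r.+1]exprS.
  move: (4 ^+ r) r1 (4 ^+ k.+2) (star R _) s s4 => v v1 u a a0 au Md.
  rewrite [a * (v * u)]mulrCA.
  move: Md W1 W; move: (_ * delta) (ray R k.+1) (ray R k) => e W1 W e0 W1W W_ge1.
  have P1 : 0 <= (2 * v + e) * (a + W) by rewrite mulr_ge0//; lra.
  have P2 : 0 <= e * W1 by rewrite mulr_ge0//; lra.
  have P3 : v * (a * u) <= v by rewrite ler_piMr//; lra.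
  have P4 : v * (32 * W) <= v * W1 by rewrite ler_wpM2l//; lra.
  have P5 : v <= v * W by rewrite ler_peMr//; lra.
  by lra.
- rewrite -leqNgt => kn; apply: (step_odd_le alive0); first exact: drift_ge0.
  have kn' : (k <= n)%N by lia.
  rewrite (drift_even kn') (drift_even (leq0n n)) subn0.
  move: kn'; rewrite leq_eqVlt => /predU1P[->|kn'].
    rewrite alive_n drift_trap subnn expr0 !mulr0 add0r !mul1r mulr1.
    have s4 : star R n.*2.+1 * 4 ^+ n <= 1 by apply: star_mul_le1; lia.
    have LE : delta * loop R n = rung R n.
      by rewrite /loop mulrA mulVf ?mul1r// gt_eqF// exprn_gt0.
    have Q := rung_ge1 R n; have s := star_gt0 R n.*2.+1.
    move: Md F s4 LE Q s; move: (4 ^+ n) (loop R n) (rung R n) (star R _).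
    move=> f L Q a Md F s4 LE Q1 a0.
    have eL : 2 * f * delta * L = 2 * f * Q by rewrite -mulrA LE.
    have P1 : 0 <= 2 * f * delta * (Q + a) by rewrite mulr_ge0//; lra.
    have P2 : Q <= f * Q by rewrite ler_peMl//; lra.
    move: P1 eL Md; move: (2 * f * delta) => e P1 eL Md; lra.
  rewrite (alive_lt _ kn') (drift_odd kn') !mul0r !add0r.
  have s := star_gt0 R k.*2.+1.
  by rewrite mulrA mulVf// mul1r mulrC ler_wpM2r ?(ltW s)//; lra.
Qed.

Lemma return_step : alive n = false -> forall x,
  (\sum_(z <oo) (p x z * (z != 0%N)%:R)%:E <= ((x != n.*2.+1)%:R : R)%:E)%E.
Proof.
move=> alive_n x; have [->|xn] := eqVneq x n.*2.+1; last first.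
  by apply: (step_sum_le1 alive0) => // y; case: (_ != _).
by apply: (step_odd_le alive0) => //; rewrite alive_n eqxx !mul0r mulr0 addr0.
Qed.
End stages.

(** * The schedule of deletions *)

Definition stage (n : nat) : nat := (2 * n * n.+1)%N.
Definition env (t : nat) : pred nat := fun k => (t < stage k)%N.

(** Stage [n] thus lasts [4 * n] steps, and that many halvings bring the bound [2 * 4 ^ n] on
    [drift] down to [2 * 4 ^- n]. *)
Lemma stageS n : stage n.+1 = (stage n + 4 * n.+1)%N.
Proof. by rewrite /stage; lia. Qed.

Lemma stage_le m n : (m <= n)%N -> (stage m <= stage n)%N.
Proof. by move=> mn; rewrite /stage leq_mul// leq_mul. Qed.

Lemma leq_stage n : (n <= stage n)%N.
Proof. by rewrite /stage; nia. Qed.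

(** Since [stage 0 = 0], the trap at the origin is never alive, which keeps the row of the origin
    constant in time. *)
Lemma env0 t : env t 0 = false.
Proof. by []. Qed.

Lemma stage_lt8 n : (stage n < 8 ^ n)%N.
Proof.
elim: n => // n IH; rewrite stageS expnS; case: n IH => // n.
by rewrite /stage; nia.
Qed.

Lemma env_decreases (R : realType) :
  decreases_to (fun t => @cond R (env t)) (cond R xpred0).
Proof.
have mono (a b : pred nat) x y : (forall k, a k -> b k) ->
    half_cond R a x y <= half_cond R b x y.
  move=> ab; have le (e : bool) k (r : R) : 1 <= r ->
      (e && a k)%:R * r <= (e && b k)%:R * r.
    move=> r1; rewrite ler_wpM2r ?(le_trans ler01)// ler_nat.
    by case: e => //=; case E : (a k) => //; rewrite ab.
  rewrite /half_cond !andbA; apply: lerD; last exact/le/loop_ge1.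
  by rewrite lerD2l; exact/le/rung_ge1.
move=> x y; split.
  move=> s t st; apply: lerD; apply: mono => k; exact: leq_ltn_trans.
(* An entry depends only on the traps [x./2] and [y./2], so it is constant once both are deleted. *)
apply: cvg_near_cst; exists (maxn (stage x./2) (stage y./2)) => // t /= Ht.
have env_dead z : (stage z <= t)%N -> env t z = false.
  by move=> zt; apply/negbTE; rewrite /env -leqNgt.
by rewrite /cond /half_cond !env_dead// (leq_trans _ Ht)// ?leq_maxl ?leq_maxr.
Qed.

Lemma cond_irreducible (R : realType) (alive : pred nat) :
  alive 0%N = false -> irreducible_walk (@cond R alive).
Proof.
move=> alive0 x y; have [d [T [P [X Xc]]]] := @cond_walk_exists R _ alive0 x.
exists d, T, P, X; split => //; exists 2%N.
(* Two steps suffice, through the origin, which is adjacent to every vertex including itself. *)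
pose z (s : nat) := if s == 0%N then x else if s == 1%N then 0%N else y.
have [mX P0 PS] := Xc.
have pos v : 0 < step_prob (@cond R alive) 0%N v.
  by apply: step_gt0 => //; apply: lt_le_trans (cond0_ge _ _ _); exact: star_gt0.
have pos' v : 0 < step_prob (@cond R alive) v 0%N.
  apply: step_gt0 => //; rewrite condC.
  by apply: lt_le_trans (cond0_ge _ _ _); exact: star_gt0.
have : (0 < P [set w | forall s, (s <= 2)%N -> X s w = z s])%E.
  rewrite !PS (_ : [set w | _] = [set w | X 0%N w = x]) ?P0; last first.
    apply/seteqP; split => w /=; first by apply.
    by move=> Xx s; rewrite leqn0 => /eqP ->.
  by rewrite mul1e -EFinM lte_fin mulr_gt0.
move/lt_le_trans; apply; rewrite le_measure ?inE//; last by move=> w /(_ 2%N (leqnn _)).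
exact: (walk_measurable_all Xc [set s | (s <= 2)%N] (fun s v => v = z s)).
Qed.

(** * Almost sure recurrence in the changing environment *)

Section recurrence.
Context (R : realType) (d : measure_display) (T : measurableType d).
Context (P : probability T R) (X : nat -> T -> nat).
Hypothesis Xc : is_walk (fun t => @cond R (env t)) 0%N P X.
Local Notation E := (expect P X (fun=> setT)).

Let p_ge0 t x z : 0 <= step_prob (@cond R (env t)) x z.
Proof. exact: step_ge0. Qed.

Let p_sum1 t x : (\sum_(z <oo) (step_prob (@cond R (env t)) x z)%:E = 1)%E.
Proof. exact: step_sum1. Qed.

(** Trap [n] is alive from time 0 until [stage n], so [exit_step] applies at each step and the
    escape probabilities add up. *)
Lemma exit_prob n t : (0 < n)%N -> (t <= stage n)%N ->
  (E t (fun x => (n.*2.+1 < x)%N%:R) <= (t%:R * (64 ^+ n)^-1)%:E)%E.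
Proof.
move=> n0; have d0 : 0 <= (64 ^+ n)^-1 :> R by rewrite invr_ge0 exprn_ge0.
elim: t => [_|t IH tn]; first by rewrite (expect0 Xc)// mul0r.
have := @expectS_le _ _ _ _ _ _ _ Xc p_ge0 (fun=> setT) t
  (fun x => (n.*2.+1 < x)%N%:R) (fun x => (n.*2.+1 < x)%N%:R + (64 ^+ n)^-1).
move=> /(_ (fun=> ler0n _ _) (exit_step R (env0 t) n0 tn)) /le_trans; apply.
rewrite expectD// -[t.+1%:R]natr1 mulrDl mul1r EFinD; apply: leeD.
  by apply: IH; exact: ltnW.
exact: (expect_cst Xc).
Qed.

(** Writing [M = 2 * 4 ^ n], each step halves the mean and adds at most [M * delta * (1 + t)], where
    [exit_prob] supplies the factor [t]. With [1 + t] at most [(stage n).+1], the geometric sum of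
    these errors gives the factor 2. *)
Lemma drift_decay m n i : n = m.+1 -> (i <= 4 * n)%N ->
  (E (stage m + i) (drift R n) <=
   (2 * 4 ^+ n * (2^-1 ^+ i + 2 * (64 ^+ n)^-1 * (stage n).+1%:R))%:E)%E.
Proof.
move=> nm; have n0 : (0 < n)%N by rewrite nm.
have d0 : 0 <= (64 ^+ n)^-1 :> R by rewrite invr_ge0 exprn_ge0.
have M1 : 1 <= 4 ^+ n :> R by exact: (expn_ge1 R 3).
have M0 : 0 <= 2 * 4 ^+ n :> R by lra.
elim: i => [_|i IH im].
  apply: (@le_trans _ _ (E (stage m + 0) (fun=> 2 * 4 ^+ n))).
    by apply: expect_le => x; [exact: drift_ge0|move=> _; exact: drift_le].
  apply: (le_trans (expect_cst Xc _ _ M0)); rewrite lee_fin expr0 ler_peMr//.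
  by rewrite lerDl !mulr_ge0.
have tn : (stage m + i < stage n)%N by rewrite nm stageS -nm; lia.
have lt_dead j : (j < n)%N -> env (stage m + i) j = false.
  rewrite nm => jm; apply/negbTE; rewrite /env -leqNgt.
  by rewrite (leq_trans (stage_le (jm : (j <= m)%N)))// leq_addr.
rewrite addnS.
have := @expectS_le _ _ _ _ _ _ _ Xc p_ge0 (fun=> setT) (stage m + i)
  (drift R n) _ (drift_ge0 R n) (drift_step R (env0 _) n0 tn lt_dead).
move=> /le_trans; apply.
have i0 x : 0 <= (n.*2.+1 < x)%N%:R :> R by [].
have D0 x := drift_ge0 R n x.
rewrite expectD; [|by move=> x; rewrite addr_ge0 ?mulr_ge0|by move=> x; rewrite mulr_ge0].
rewrite expectD; [|by move=> x; rewrite mulr_ge0|by move=> x; rewrite mulr_ge0].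
rewrite (expectZ P X _ _ 2^-1 D0) (expectZ P X _ _ _ i0).
have {}IH := IH (ltnW im).
have e2 := exit_prob n0 (ltnW tn).
have Md0 : 0 <= 2 * 4 ^+ n * (64 ^+ n)^-1 :> R by rewrite mulr_ge0.
have e1 := expect_cst Xc (fun=> setT) (stage m + i) Md0.
apply: (le_trans (leeD (leeD (lee_wpmul2l _ IH) e1) (lee_wpmul2l _ e2))).
- by rewrite lee_fin.
- by rewrite lee_fin.
rewrite -!EFinM -!EFinD lee_fin.
have tS : ((stage m + i)%:R + 1 <= (stage n).+1%:R :> R).
  by rewrite natr1 ler_nat ltnS ltnW.
have := ler_wpM2l Md0 tS.
rewrite exprS; move: (2^-1 ^+ i) (stage n).+1%:R (stage m + i)%:R => a s t.
by move: (4 ^+ n) (64 ^+ n)^-1 => f g; lra.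
Qed.

Lemma return_prob n : (0 < n)%N ->
  (E (stage n).+1 (fun x => (x != 0%N)%:R) <= (6 * 2^-1 ^+ n)%:E)%E.
Proof.
case: n => // m _; set n := m.+1.
(* At time [stage n] itself trap [n] is already deleted, the inequality in [env] being strict, so
   the step out of that time sends the trap to the origin. *)
have := @expectS_le _ _ _ _ _ _ _ Xc p_ge0 (fun=> setT) (stage n)
  (fun x => (x != 0%N)%:R) _ (fun=> ler0n _ _) (return_step R (env0 _) (ltnn (stage n))).
move=> /le_trans; apply.
apply: (@le_trans _ _ (E (stage n) (drift R n))).
  by apply: expect_le => // x _; exact: drift_ge.
rewrite [X in E X]stageS; apply: (le_trans (drift_decay (erefl _) (leqnn _))).
rewrite lee_fin -/n; have S8 : (stage n).+1%:R <= 2 ^+ n ^+ 3 :> R.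
  by rewrite -exprM mulnC exprM -!natrX ler_nat stage_lt8.
have -> : 4 ^+ n = 2 ^+ n ^+ 2 :> R.
  by rewrite -exprM mulnC exprM; congr (_ ^+ _); rewrite expr2; lra.
have -> : 64 ^+ n = 2 ^+ n ^+ 6 :> R.
  by rewrite -exprM mulnC exprM; congr (_ ^+ _); rewrite !exprS expr0; lra.
rewrite !exprVn exprM.
(* In terms of [u = 2 ^ n] the bound is [2 * u ^ 2 * (u ^- 4 + 2 * u ^- 6 * u ^ 3) = 2 * u ^- 2 + 4
   * u ^- 1], at most [6 * u ^- 1]. *)
have u1 := @expn_ge1 R 1 n.
have -> : 2 ^+ 4 ^+ n = 2 ^+ n ^+ 4 :> R by rewrite -!exprM mulnC.
move: (2 ^+ n) u1 (stage n).+1%:R S8 => u u1 s su.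
have u0 : u != 0 by rewrite gt_eqF// (lt_le_trans ltr01).
have v0 : 0 <= u^-1 ^+ 6 by rewrite exprn_ge0// invr_ge0 (le_trans ler01).
apply: (@le_trans _ _ (2 * u ^+ 2 * ((u ^+ 4)^-1 + 2 * (u ^+ 6)^-1 * u ^+ 3))).
  rewrite ler_wpM2l ?lerD2l ?ler_wpM2l//.
    by rewrite mulr_ge0// exprn_ge0// (le_trans ler01).
  by rewrite mulr_ge0// -exprVn.
have -> : 2 * u ^+ 2 * ((u ^+ 4)^-1 + 2 * (u ^+ 6)^-1 * u ^+ 3) =
  2 * u^-1 * u^-1 + 4 * u^-1 by field.
have : 0 <= u^-1 by rewrite invr_ge0 (le_trans ler01).
have : u^-1 <= 1 by rewrite invf_le1// (lt_le_trans ltr01).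
by nra.
Qed.

Lemma walk_recurrent :
  {ae P, forall w, forall v, visits_infinitely_often (X ^~ w) v}.
Proof.
(* The origin's row is the same at all times, so its initial jump probability to [v] serves as the
   uniform [p0] of [avoid_null]. *)
have start v t : step_prob (@cond R (env 0)) 0%N v <= step_prob (@cond R (env t)) 0%N v.
  have E0 y : @cond R (env 0) 0%N y = @cond R (env t) 0%N y.
    by case: y => [|y]; rewrite /cond /half_cond /= ?env0 ?andbF.
  by rewrite /step_prob /total_conductance (eq_esum (fun y _ => congr1 EFin (E0 y))) E0.
have back N (e : R) : 0 < e -> exists2 t, (N <= t)%N &
    (E t (fun x => (x != 0%N)%:R) <= e%:E)%E.
  move=> e0; have e6 : 0 < e / 6 by rewrite divr_gt0.
  have [M _ HM] : \forall n \near \oo, (2^-1 : R) ^+ n < e / 6.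
    have /cvgr0_norm_lt /(_ _ e6) : (2^-1 : R) ^+ n @[n --> \oo] --> (0 : R).
      by apply: cvg_expr; rewrite ger0_norm ?invr_ge0// invf_lt1// ltr1n.
    by apply: filterS => n; exact: le_lt_trans (ler_norm _).
  pose n := (maxn M N).+1.
  exists (stage n).+1.
    rewrite leqW// (leq_trans _ (leq_stage n))//.
    by rewrite /n leqW// leq_maxr.
  apply: (le_trans (return_prob _)) => //; rewrite lee_fin.
  have := HM n; rewrite /= /n leqW ?leq_maxl// => /(_ isT); lra.
have null v N : P [set w | forall s, (N <= s)%N -> X s w <> v] = 0%E.
  apply: (avoid_null Xc p_ge0 p_sum1 _ (start v) back).
  by apply: step_gt0 => //; apply: lt_le_trans (cond0_ge _ _ _); exact: star_gt0.
have neg : P.-negligible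
    (\bigcup_v \bigcup_N [set w | forall s, (N <= s)%N -> X s w <> v]).
  apply: negligible_bigcup => v; apply: negligible_bigcup => N.
  exists [set w | forall s, (N <= s)%N -> X s w <> v]; split => //.
    exact: (walk_measurable_all Xc [set s | (N <= s)%N] (fun _ x => x <> v)).
  exact: null.
apply: (negligibleS _ neg) => w /= /existsNP[v /existsNP[N H]].
by exists v => //; exists N => // s Ns Xs; apply: H; exists s.
Qed.
End recurrence.

(** * The counterexample *)

Theorem theorem1p9 (R : realType) :
  (exists (V : countType) (cinf : V -> V -> R) (v0 : V)
      (c : nat -> V -> V -> R),
    [/\ is_network cinf, connected_network cinf & locally_finite cinf] /\
    [/\ forall t, is_network (c t), forall t, locally_finite (c t)
      & decreases_to c cinf] /\
    transient cinf /\ (forall t, transient (c t)) /\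
    (exists (d : measure_display) (T : measurableType d)
        (P : probability T R) (X : nat -> T -> V), is_walk c v0 P X) /\
    (forall (d : measure_display) (T : measurableType d)
        (P : probability T R) (X : nat -> T -> V),
      is_walk c v0 P X ->
      {ae P, forall w, forall v, visits_infinitely_often (X ^~ w) v})) /\
  ~ (forall (V : countType) (cinf : V -> V -> R) (v0 : V)
        (c : nat -> V -> V -> R),
      is_network cinf -> locally_finite cinf ->
      (forall t, is_network (c t)) -> (forall t, locally_finite (c t)) ->
      decreases_to c cinf ->
      irreducible_walk cinf -> transient cinf ->
      forall (d : measure_display) (T : measurableType d)
        (P : probability T R) (X : nat -> T -> V),
      is_walk c v0 P X ->
      {ae P, forall w, forall v, visits_finitely_often (X ^~ w) v}).
Proof.
pose cinf : nat -> nat -> R := cond R xpred0.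
pose c t : nat -> nat -> R := cond R (env t).
have inf0 : xpred0 0%N = false by [].
have net : is_network cinf by exact: cond_network.
have lf : locally_finite cinf by exact: cond_locally_finite.
have nets t : is_network (c t) by exact: cond_network.
have lfs t : locally_finite (c t) by exact: (cond_locally_finite R (env0 t)).
have dec : decreases_to c cinf by exact: env_decreases.
have tr : transient cinf by exact: cond_transient.
have [d [T [P [X Xc]]]] : exists (d : measure_display) (T : measurableType d)
    (P : probability T R) (X : nat -> T -> nat), is_walk c 0%N P X.
  by apply: walk_exists => *; [exact: step_ge0|exact: step_sum1].
split.
  exists nat, cinf, 0%N, c; split; first by split => //; exact: cond_connected.
  split => //; split => //; split; first by move=> t; exact: (cond_transient R (env0 t)).
  by split; [exists d, T, P, X|move=> *; exact: walk_recurrent].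
move=> /(_ nat cinf 0%N c net lf nets lfs dec (cond_irreducible R inf0) tr
  d T P X Xc) fin.
have inf := walk_recurrent Xc.
(* Both almost sure statements fail together nowhere yet contradict each other at vertex 0, so the
   union of their exceptional sets is the whole space, which would be null. *)
have [A [mA PA sA]] : P.-negligible [set: T].
  apply: negligibleS (negligibleU fin inf) => w _ /=.
  apply: contrapT => /not_orP[/contrapT H1 /contrapT H2].
  have [N HN] := H1 0%N; have [n Nn Xn] := H2 0%N N.
  exact: HN Nn Xn.
have : (P [set: T] <= P A)%E by rewrite le_measure ?inE.
by rewrite PA probability_setT lee_fin ler10.
Qed.
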